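(* Let $H\in\mathbb{R}$, let $U\subset\mathbb{C}$ be an open set containing the closed unit disc $\overline{\mathbb{D}}=\mathbb{D}\cup\partial\mathbb{D}$, and let $f:U\to\mathbb{R}^3$ be a conformal immersion with constant mean curvature $H$ (with respect to a unit normal field $N$), such that the boundary curve $\gamma(t)=f(e^{it})$, $t\in[0,2\pi]$, is a regular real-analytic closed curve $C=f(\partial\mathbb{D})$. Let $\kappa_n$ and $\tau_g$ denote the normal curvature and geodesic torsion of $\gamma$ with respect to $f$. Then: (1) The surface $f(\overline{\mathbb{D}})$ is totally umbilic if and only if at least one of $\kappa_n$, $\tau_g$ is constant along $\gamma$. In this case both are constant, and $\kappa_n\equiv H$ and $\tau_g\equiv 0$. (2) Otherwise, the mean curvature satisfies \[\min_{\partial\mathbb{D}}\kappa_n \;<\; H \;<\; \max_{\partial\mathbb{D}}\kappa_n .\]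
   Context: Conformal means $\langle f_x,f_x\rangle=\langle f_y,f_y\rangle>0$ and $\langle f_x,f_y\rangle=0$ for $z=x+iy$; the mean curvature is $H=\frac{1}{2}\nu^{-2}\langle f_{xx}+f_{yy},N\rangle$ where $\nu^2=\langle f_x,f_x\rangle$. Totally umbilic means every point is an umbilic (the surface is part of a round sphere or a plane). Along the boundary curve, let $s$ be arc length, $X=d\gamma/ds$ the unit tangent, $N$ the surface unit normal restricted to $\gamma$, and $Y=N\times X$ the unit conormal (Darboux frame). The normal curvature is $\kappa_n=\langle dX/ds, N\rangle$ and the geodesic torsion is $\tau_g=\langle dY/ds, N\rangle=-\langle dN/ds, Y\rangle$. *)

(* Defs.v *)
From Stdlib Require Import Reals Lra List.
From Coquelicot Require Import Coquelicot.
Open Scope R_scope.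

Record V3 := mkV3 { v1 : R; v2 : R; v3 : R }.

Definition dot (a b : V3) : R := v1 a * v1 b + v2 a * v2 b + v3 a * v3 b.
Definition vnorm (a : V3) : R := sqrt (dot a a).
Definition vadd (a b : V3) : V3 := mkV3 (v1 a + v1 b) (v2 a + v2 b) (v3 a + v3 b).
Definition vscale (c : R) (a : V3) : V3 := mkV3 (c * v1 a) (c * v2 a) (c * v3 a).
Definition cross (a b : V3) : V3 :=
  mkV3 (v2 a * v3 b - v3 a * v2 b)
       (v3 a * v1 b - v1 a * v3 b)
       (v1 a * v2 b - v2 a * v1 b).

Definition pdx (g : R -> R -> R) : R -> R -> R := fun x y => Derive (fun t => g t y) x.
Definition pdy (g : R -> R -> R) : R -> R -> R := fun x y => Derive (fun t => g x t) y.
Definition pd (d : bool) (g : R -> R -> R) := if d then pdx g else pdy g.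

Fixpoint pds (w : list bool) (g : R -> R -> R) : R -> R -> R :=
  match w with nil => g | d :: w' => pd d (pds w' g) end.

Definition smooth_on (U : R -> R -> Prop) (g : R -> R -> R) : Prop :=
  forall (w : list bool) (p q : R), U p q ->
    ex_derive (fun t => pds w g t q) p /\
    ex_derive (fun t => pds w g p t) q /\
    continuous (fun z : R * R => pds w g (fst z) (snd z)) (p, q).

Definition comp1 (f : R -> R -> V3) := fun x y => v1 (f x y).
Definition comp2 (f : R -> R -> V3) := fun x y => v2 (f x y).
Definition comp3 (f : R -> R -> V3) := fun x y => v3 (f x y).

Definition vsmooth_on (U : R -> R -> Prop) (f : R -> R -> V3) : Prop :=
  smooth_on U (comp1 f) /\ smooth_on U (comp2 f) /\ smooth_on U (comp3 f).

Definition vpdx (f : R -> R -> V3) : R -> R -> V3 :=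
  fun x y => mkV3 (pdx (comp1 f) x y) (pdx (comp2 f) x y) (pdx (comp3 f) x y).
Definition vpdy (f : R -> R -> V3) : R -> R -> V3 :=
  fun x y => mkV3 (pdy (comp1 f) x y) (pdy (comp2 f) x y) (pdy (comp3 f) x y).

Definition open2 (U : R -> R -> Prop) : Prop :=
  forall x y, U x y -> exists eps, 0 < eps /\
    forall x' y', (x' - x) ^ 2 + (y' - y) ^ 2 < eps ^ 2 -> U x' y'.

Definition closed_disc (x y : R) : Prop := x ^ 2 + y ^ 2 <= 1.

Definition conformal_on (U : R -> R -> Prop) (f : R -> R -> V3) : Prop :=
  forall x y, U x y ->
    dot (vpdx f x y) (vpdx f x y) = dot (vpdy f x y) (vpdy f x y) /\
    0 < dot (vpdx f x y) (vpdx f x y) /\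
    dot (vpdx f x y) (vpdy f x y) = 0.

Definition unit_normal_on (U : R -> R -> Prop) (f N : R -> R -> V3) : Prop :=
  forall x y, U x y ->
    dot (N x y) (N x y) = 1 /\
    dot (N x y) (vpdx f x y) = 0 /\
    dot (N x y) (vpdy f x y) = 0.

Definition mean_curv (f N : R -> R -> V3) (x y : R) : R :=
  / 2 * / dot (vpdx f x y) (vpdx f x y) *
  dot (vadd (vpdx (vpdx f) x y) (vpdy (vpdy f) x y)) (N x y).

Definition umbilic (f N : R -> R -> V3) (x y : R) : Prop :=
  exists lam : R,
    dot (vpdx (vpdx f) x y) (N x y) = lam * dot (vpdx f x y) (vpdx f x y) /\
    dot (vpdy (vpdx f) x y) (N x y) = lam * dot (vpdx f x y) (vpdy f x y) /\
    dot (vpdy (vpdy f) x y) (N x y) = lam * dot (vpdy f x y) (vpdy f x y).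

Definition totally_umbilic_disc (f N : R -> R -> V3) : Prop :=
  forall x y, closed_disc x y -> umbilic f N x y.

Definition vderive (c : R -> V3) : R -> V3 :=
  fun t => mkV3 (Derive (fun s => v1 (c s)) t) (Derive (fun s => v2 (c s)) t)
                (Derive (fun s => v3 (c s)) t).

Definition gam (f : R -> R -> V3) : R -> V3 := fun t => f (cos t) (sin t).
Definition speed (f : R -> R -> V3) (t : R) : R := vnorm (vderive (gam f) t).
Definition tangX (f : R -> R -> V3) : R -> V3 :=
  fun t => vscale (/ speed f t) (vderive (gam f) t).
Definition Nb (N : R -> R -> V3) : R -> V3 := fun t => N (cos t) (sin t).
Definition conY (f N : R -> R -> V3) : R -> V3 := fun t => cross (Nb N t) (tangX f t).
(* d/ds = (1/|gamma'(t)|) d/dt *)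
Definition kappa_n (f N : R -> R -> V3) (t : R) : R :=
  dot (vderive (tangX f) t) (Nb N t) / speed f t.
Definition tau_g (f N : R -> R -> V3) (t : R) : R :=
  dot (vderive (conY f N) t) (Nb N t) / speed f t.

Definition real_analytic (g : R -> R) : Prop :=
  forall t0, exists (a : nat -> R) (r : R), 0 < r /\
    forall t, Rabs (t - t0) < r -> is_pseries a (t - t0) (g t).

Definition regular_analytic_boundary (f : R -> R -> V3) : Prop :=
  real_analytic (fun t => v1 (gam f t)) /\
  real_analytic (fun t => v2 (gam f t)) /\
  real_analytic (fun t => v3 (gam f t)) /\
  forall t, vderive (gam f) t <> mkV3 0 0 0.

Definition const_on_circle (k : R -> R) : Prop :=
  forall t1 t2, 0 <= t1 <= 2 * PI -> 0 <= t2 <= 2 * PI -> k t1 = k t2.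

(* Main.v *)
(** With [E = <f_x, f_x>] and [L, M, N'] the coefficients of the second fundamental form,
    the Codazzi equations together with constancy of [H] say that the Hopf differential
    [phi = (L - N') / 2 - i M] satisfies the Cauchy-Riemann equations. On the unit circle
    [kappa_n = H - Re (z^2 phi) / E] and [tau_g = +- Im (z^2 phi) / E]. The function
    [z^2 phi] vanishes at [0], so its real and imaginary parts have mean zero over the
    circle. Hence each of them has a zero on the circle, which forces a constant [kappa_n]
    to be [H] and a constant [tau_g] to be [0]; and a real part of constant sign on the
    circle vanishes there. If one of the two parts vanishes on the circle, the mean value
    property of [(z^2 phi)^2] makes the other vanish too, and then [phi = 0] on the disc by
    Cauchy's formula: the surface is totally umbilic. *)

Require Import Defs.
From Stdlib Require Import Reals Lra Psatz List.
From Coquelicot Require Import Coquelicot.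
Open Scope R_scope.

(** The metric factor [E] varies along the circle, so [kappa_n] need not have mean [H]: only the
    zeros and signs of the two parts of [z^2 phi] survive the division by [E], and the argument uses
    nothing else about them. The factor [z^2] does two jobs. It comes from evaluating the second
    fundamental form on the tangent direction [i z] of the circle, and it makes the function vanish
    at the centre.

    The complex analysis is done on pairs of real functions. Holomorphy is available at the points
    of the closed disc, boundary included, whereas differentiation under the integral sign wants the
    parameter to move freely to both sides. A linear contraction parameter would leave the disc just
    beyond [1]; its replacement by a squared sine removes the endpoints. The single identity
    obtained this way yields both the mean value property and Cauchy's formula, and multiplication
    by [-i] carries every statement about real parts over to imaginary parts. *)

(** * Calculus of functions of two real variables *)

Lemma continuity_2d_pt_comp (f g h : R -> R -> R) (x y : R) :
  continuity_2d_pt f (g x y) (h x y) ->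
  continuity_2d_pt g x y -> continuity_2d_pt h x y ->
  continuity_2d_pt (fun u v => f (g u v) (h u v)) x y.
Proof.
  intros Hf Hg Hh eps.
  destruct (Hf eps) as [d Hd].
  apply (locally_2d_impl (fun u v => Rabs (g u v - g x y) < d /\ Rabs (h u v - h x y) < d)).
  - apply locally_2d_forall; intros u v [H1 H2]; now apply Hd.
  - apply locally_2d_and; [apply Hg | apply Hh].
Qed.

Lemma continuity_2d_pt_fst (f : R -> R) (x y : R) :
  continuous f x -> continuity_2d_pt (fun u _ => f u) x y.
Proof.
  intros Hf. apply (continuity_1d_2d_pt_comp f (fun u _ => u)).
  - now apply continuity_pt_filterlim.
  - apply continuity_2d_pt_id1.
Qed.

Lemma continuity_2d_pt_snd (f : R -> R) (x y : R) :
  continuous f y -> continuity_2d_pt (fun _ v => f v) x y.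
Proof.
  intros Hf. apply (continuity_1d_2d_pt_comp f (fun _ v => v)).
  - now apply continuity_pt_filterlim.
  - apply continuity_2d_pt_id2.
Qed.

Lemma continuous_of_2d (f : R -> R -> R) (g h : R -> R) (t : R) :
  continuity_2d_pt f (g t) (h t) -> continuous g t -> continuous h t ->
  continuous (fun s => f (g s) (h s)) t.
Proof.
  intros Hf Hg Hh. apply (continuous_comp_2 g h f t Hg Hh).
  now apply continuity_2d_pt_filterlim.
Qed.

(** The error of the linear approximation is exactly [(u - a) * (v - b)], so [eps] itself serves as
    the radius. *)
Lemma differentiable_pt_lim_mult_id (a b : R) : differentiable_pt_lim Rmult a b b a.
Proof.
  intros eps. exists eps. intros u v Hu Hv.
  replace (u * v - a * b - (b * (u - a) + a * (v - b))) with ((u - a) * (v - b)) by ring.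
  rewrite Rabs_mult.
  apply Rmult_le_compat; try apply Rabs_pos.
  - now apply Rlt_le.
  - apply Rmax_r.
Qed.

Lemma differentiable_pt_lim_plus_id (a b : R) : differentiable_pt_lim Rplus a b 1 1.
Proof.
  intros eps. exists eps. intros u v _ _.
  replace (u + v - (a + b) - (1 * (u - a) + 1 * (v - b))) with 0 by ring.
  rewrite Rabs_R0. apply Rmult_le_pos; [apply Rlt_le, cond_pos |].
  apply Rle_trans with (Rabs (u - a)); [apply Rabs_pos | apply Rmax_l].
Qed.

Lemma differentiable_pt_lim_const (c a b : R) : differentiable_pt_lim (fun _ _ => c) a b 0 0.
Proof.
  intros eps. exists eps. intros u v _ _.
  replace (c - c - (0 * (u - a) + 0 * (v - b))) with 0 by ring.
  rewrite Rabs_R0. apply Rmult_le_pos; [apply Rlt_le, cond_pos |].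
  apply Rle_trans with (Rabs (u - a)); [apply Rabs_pos | apply Rmax_l].
Qed.

Lemma differentiable_pt_lim_fst (a b : R) : differentiable_pt_lim (fun u _ => u) a b 1 0.
Proof. apply (differentiable_pt_lim_proj1_0 (fun u => u)), derivable_pt_lim_id. Qed.

Lemma differentiable_pt_lim_snd (a b : R) : differentiable_pt_lim (fun _ v => v) a b 0 1.
Proof.
  intros eps. exists eps. intros u v _ _.
  replace (v - b - (0 * (u - a) + 1 * (v - b))) with 0 by ring.
  rewrite Rabs_R0. apply Rmult_le_pos; [apply Rlt_le, cond_pos |].
  apply Rle_trans with (Rabs (u - a)); [apply Rabs_pos | apply Rmax_l].
Qed.

Lemma differentiable_pt_lim_eq (f : R -> R -> R) (x y a b a' b' : R) :
  differentiable_pt_lim f x y a b -> a = a' -> b = b' ->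
  differentiable_pt_lim f x y a' b'.
Proof. now intros D -> ->. Qed.

Lemma differentiable_pt_lim_mult (f g : R -> R -> R) (x y fx fy gx gy : R) :
  differentiable_pt_lim f x y fx fy -> differentiable_pt_lim g x y gx gy ->
  differentiable_pt_lim (fun u v => f u v * g u v) x y
    (fx * g x y + f x y * gx) (fy * g x y + f x y * gy).
Proof.
  intros Df Dg.
  eapply differentiable_pt_lim_eq;
    [exact (differentiable_pt_lim_comp _ _ _ _ _ _ _ _ _ _ _
              (differentiable_pt_lim_mult_id _ _) Df Dg) | ring | ring].
Qed.

Lemma differentiable_pt_lim_plus (f g : R -> R -> R) (x y fx fy gx gy : R) :
  differentiable_pt_lim f x y fx fy -> differentiable_pt_lim g x y gx gy ->
  differentiable_pt_lim (fun u v => f u v + g u v) x y (fx + gx) (fy + gy).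
Proof.
  intros Df Dg.
  eapply differentiable_pt_lim_eq;
    [exact (differentiable_pt_lim_comp _ _ _ _ _ _ _ _ _ _ _
              (differentiable_pt_lim_plus_id _ _) Df Dg) | ring | ring].
Qed.

Lemma differentiable_pt_lim_scal (c : R) (f : R -> R -> R) (x y fx fy : R) :
  differentiable_pt_lim f x y fx fy ->
  differentiable_pt_lim (fun u v => c * f u v) x y (c * fx) (c * fy).
Proof.
  intros Df.
  eapply differentiable_pt_lim_eq;
    [exact (differentiable_pt_lim_mult _ _ _ _ _ _ _ _
              (differentiable_pt_lim_const c x y) Df) | cbv beta; ring | cbv beta; ring].
Qed.

Lemma differentiable_pt_lim_minus (f g : R -> R -> R) (x y fx fy gx gy : R) :
  differentiable_pt_lim f x y fx fy -> differentiable_pt_lim g x y gx gy ->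
  differentiable_pt_lim (fun u v => f u v - g u v) x y (fx - gx) (fy - gy).
Proof.
  intros Df Dg.
  apply (differentiable_pt_lim_ext (fun u v => f u v + (-1) * g u v)).
  { apply locally_2d_forall; intros; ring. }
  eapply differentiable_pt_lim_eq;
    [exact (differentiable_pt_lim_plus _ _ _ _ _ _ _ _ Df
              (differentiable_pt_lim_scal (-1) _ _ _ _ _ Dg)) | ring | ring].
Qed.

Lemma differentiable_pt_lim_continuity (f : R -> R -> R) (x y fx fy : R) :
  differentiable_pt_lim f x y fx fy -> continuity_2d_pt f x y.
Proof. intros Df. apply differentiable_continuity_pt. now exists fx, fy. Qed.

Lemma is_derive_comp_2d (f : R -> R -> R) (g h : R -> R) (t fx fy dg dh : R) :
  differentiable_pt_lim f (g t) (h t) fx fy -> is_derive g t dg -> is_derive h t dh ->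
  is_derive (fun s => f (g s) (h s)) t (fx * dg + fy * dh).
Proof.
  intros Df Dg Dh. apply is_derive_Reals.
  apply derivable_pt_lim_comp_2d; trivial; now apply is_derive_Reals.
Qed.

(** * Integrals of continuous functions *)

Lemma RInt_Rconst (a b c : R) : RInt (fun _ : R => c) a b = (b - a) * c.
Proof. exact (RInt_const a b c). Qed.

Lemma RInt_circle_ext (f g : R -> R) :
  (forall t, 0 < t < 2 * PI -> f t = g t) -> RInt f 0 (2 * PI) = RInt g 0 (2 * PI).
Proof.
  intros E. apply RInt_ext. assert (Z := PI_RGT_0).
  rewrite Rmin_left, Rmax_right by lra. exact E.
Qed.

(** Mean value theorem for the primitive of [v]. *)
Lemma RInt_zero_has_root (v : R -> R) (a b : R) :
  a < b -> (forall t, continuous v t) -> RInt v a b = 0 ->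
  exists t, a <= t <= b /\ v t = 0.
Proof.
  intros Hab Hv Hint.
  assert (D : forall t, is_derive (fun s => RInt v a s) t (v t)).
  { intros t. apply (is_derive_RInt v _ a); [| apply Hv].
    apply filter_forall; intros s. apply (RInt_correct (V := R_CompleteNormedModule)), (ex_RInt_continuous (V := R_CompleteNormedModule)); auto. }
  destruct (MVT_gen (fun s => RInt v a s) a b v) as (c & Hc & E).
  - intros t _. apply D.
  - intros t _. apply continuity_pt_filterlim, (ex_derive_continuous (fun s : R => RInt v a s) t).
    now exists (v t).
  - rewrite Rmin_left, Rmax_right in Hc by lra.
    exists c; split; [exact Hc |].
    rewrite Hint, RInt_point in E. unfold zero in E; simpl in E.
    apply Rmult_eq_reg_r with (b - a); lra.
Qed.

(** The primitive is squeezed between [0] and the total integral, hence vanishes on the interval,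
    and so does its derivative [v]. Interior points suffice later: the vanishing is only fed into
    integrals over the circle. *)
Lemma nonneg_RInt_zero (v : R -> R) (a b : R) :
  (forall t, continuous v t) -> (forall t, a <= t <= b -> 0 <= v t) ->
  RInt v a b = 0 -> forall t, a < t < b -> v t = 0.
Proof.
  intros Hv Hpos Hint t Ht.
  assert (EX : forall r s, ex_RInt v r s) by (intros; apply (ex_RInt_continuous (V := R_CompleteNormedModule)); auto).
  assert (Z : forall s, a < s < b -> RInt v a s = 0).
  { intros s Hs.
    assert (C := RInt_Chasles v a s b (EX _ _) (EX _ _)).
    rewrite Hint in C. change (RInt v a s + RInt v s b = 0) in C.
    assert (0 <= RInt v a s) by (apply RInt_ge_0; auto; [lra | intros; apply Hpos; lra]).
    assert (0 <= RInt v s b) by (apply RInt_ge_0; auto; [lra | intros; apply Hpos; lra]).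
    lra. }
  assert (D : is_derive (fun s => RInt v a s) t (v t)).
  { apply (is_derive_RInt v _ a); [| apply Hv].
    apply filter_forall; intros s. now apply (RInt_correct (V := R_CompleteNormedModule)). }
  assert (D0 : is_derive (fun s => RInt v a s) t 0).
  { apply (is_derive_ext_loc (fun _ => 0)).
    - assert (L : locally t (fun s => a < s < b)).
      { apply (open_and (fun s => a < s) (fun s => s < b)); [apply open_gt | apply open_lt | exact Ht]. }
      revert L; apply filter_imp. intros s Hs. now rewrite Z.
    - apply (is_derive_const 0 t). }
  apply is_derive_unique in D. apply is_derive_unique in D0. congruence.
Qed.

(** * Holomorphic functions on the closed disc *)

(* [P + i Q] is holomorphic at each point of the closed disc, with complex
   derivative [Px - i Py]. *)
Definition holo_disc (P Q : R -> R -> R) : Prop :=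
  exists Px Py : R -> R -> R, forall x y, closed_disc x y ->
    differentiable_pt_lim P x y (Px x y) (Py x y) /\
    differentiable_pt_lim Q x y (- Py x y) (Px x y) /\
    continuity_2d_pt Px x y /\ continuity_2d_pt Py x y.

Lemma holo_disc_continuity (P Q : R -> R -> R) (x y : R) :
  holo_disc P Q -> closed_disc x y -> continuity_2d_pt P x y /\ continuity_2d_pt Q x y.
Proof.
  intros (Px & Py & Hh) Hxy. destruct (Hh x y Hxy) as (DP & DQ & _).
  split; eapply differentiable_pt_lim_continuity; eassumption.
Qed.

Lemma holo_disc_id : holo_disc (fun x _ => x) (fun _ y => y).
Proof.
  exists (fun _ _ => 1), (fun _ _ => 0). intros x y _.
  repeat split; try apply continuity_2d_pt_const.
  - apply differentiable_pt_lim_fst.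
  - eapply differentiable_pt_lim_eq; [apply differentiable_pt_lim_snd | ring | ring].
Qed.

Lemma holo_disc_mul (P Q P' Q' : R -> R -> R) :
  holo_disc P Q -> holo_disc P' Q' ->
  holo_disc (fun x y => P x y * P' x y - Q x y * Q' x y)
            (fun x y => P x y * Q' x y + Q x y * P' x y).
Proof.
  intros HP HP'.
  assert (C := fun x y => holo_disc_continuity P Q x y HP).
  assert (C' := fun x y => holo_disc_continuity P' Q' x y HP').
  destruct HP as (Px & Py & Hh). destruct HP' as (Px' & Py' & Hh').
  exists (fun x y => (Px x y * P' x y + P x y * Px' x y) - (- Py x y * Q' x y + Q x y * - Py' x y)),
         (fun x y => (Py x y * P' x y + P x y * Py' x y) - (Px x y * Q' x y + Q x y * Px' x y)).
  intros x y Hxy.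
  destruct (Hh x y Hxy) as (DP & DQ & Cx & Cy).
  destruct (Hh' x y Hxy) as (DP' & DQ' & Cx' & Cy').
  destruct (C x y Hxy) as (CP & CQ). destruct (C' x y Hxy) as (CP' & CQ').
  repeat split.
  - apply differentiable_pt_lim_minus; now apply differentiable_pt_lim_mult.
  - eapply differentiable_pt_lim_eq;
      [apply differentiable_pt_lim_plus; apply differentiable_pt_lim_mult; eassumption | ring | ring].
  - repeat first [apply continuity_2d_pt_minus | apply continuity_2d_pt_plus
                 | apply continuity_2d_pt_mult | apply continuity_2d_pt_opp]; assumption.
  - repeat first [apply continuity_2d_pt_minus | apply continuity_2d_pt_plus
                 | apply continuity_2d_pt_mult]; assumption.
Qed.

(** Multiplication by [-i]. *)
Lemma holo_disc_rot (P Q : R -> R -> R) :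
  holo_disc P Q -> holo_disc Q (fun x y => - P x y).
Proof.
  intros (Px & Py & Hh).
  exists (fun x y => - Py x y), Px. intros x y Hxy.
  destruct (Hh x y Hxy) as (DP & DQ & Cx & Cy).
  repeat split; trivial.
  - apply (differentiable_pt_lim_ext (fun u v => (-1) * P u v)).
    { apply locally_2d_forall; intros; ring. }
    eapply differentiable_pt_lim_eq;
      [apply differentiable_pt_lim_scal; eassumption | ring | ring].
  - now apply continuity_2d_pt_opp.
Qed.

Lemma closed_disc_circle (t : R) : closed_disc (cos t) (sin t).
Proof. unfold closed_disc. assert (E := sin2_cos2 t); unfold Rsqr in E; nra. Qed.

Lemma closed_disc_segment (a b s t : R) :
  closed_disc a b -> 0 <= s <= 1 ->
  closed_disc (a + s * (cos t - a)) (b + s * (sin t - b)).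
Proof.
  unfold closed_disc; intros Hab Hs.
  assert (E := sin2_cos2 t); unfold Rsqr in E.
  set (c := cos t) in *; set (d := sin t) in *.
  replace ((a + s * (c - a)) ^ 2 + (b + s * (d - b)) ^ 2)
    with ((1 - s) * (a ^ 2 + b ^ 2) + s * (d * d + c * c)
          - s * (1 - s) * ((a - c) ^ 2 + (b - d) ^ 2)) by ring.
  rewrite E.
  assert (0 <= s * (1 - s) * ((a - c) ^ 2 + (b - d) ^ 2)).
  { apply Rmult_le_pos; [apply Rmult_le_pos; lra | apply Rplus_le_le_0_compat; apply pow2_ge_0]. }
  nra.
Qed.

Lemma sin_sqr_bounds (th : R) : 0 <= sin th ^ 2 <= 1.
Proof. assert (E := sin2_cos2 th); unfold Rsqr in E; nra. Qed.

(* The hypotheses on [k + i l] say that it equals [z / (z - w)] with [z = e^(it)],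
   [w = a + i b]. Contracting the circle towards [w] along [w + sin^2 th (z - w)]
   stays in the closed disc for every real [th]; the [th]-derivative of the integral
   is that of an exact form in [t]. *)
Lemma cauchy_disc (P Q : R -> R -> R) (a b : R) (k l : R -> R) :
  holo_disc P Q -> closed_disc a b ->
  (forall t, continuous k t) -> (forall t, continuous l t) ->
  (forall t, k t * (cos t - a) - l t * (sin t - b) = cos t) ->
  (forall t, k t * (sin t - b) + l t * (cos t - a) = sin t) ->
  RInt (fun t => P (cos t) (sin t) * k t - Q (cos t) (sin t) * l t) 0 (2 * PI)
  = RInt (fun t => P a b * k t - Q a b * l t) 0 (2 * PI).
Proof.
  intros HPQ Hab Ck Cl K1 K2.
  destruct HPQ as (Px & Py & Hh).
  set (X := fun th t => a + sin th ^ 2 * (cos t - a)).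
  set (Y := fun th t => b + sin th ^ 2 * (sin t - b)).
  assert (HXY : forall th t, closed_disc (X th t) (Y th t)).
  { intros th t. apply closed_disc_segment; [exact Hab | apply sin_sqr_bounds]. }
  set (F := fun th t => P (X th t) (Y th t) * k t - Q (X th t) (Y th t) * l t).
  (* With [phi = P + i Q] this is [2 sin th cos th Re (phi' z)]: the factor [z - w] from the chain
     rule cancels the denominator of the kernel [z / (z - w)]. *)
  set (D := fun th t => 2 * sin th * cos th *
              (Px (X th t) (Y th t) * cos t + Py (X th t) (Y th t) * sin t)).
  assert (DF : forall th t, is_derive (fun s => F s t) th (D th t)).
  { intros th t. destruct (Hh _ _ (HXY th t)) as (DP & DQ & _ & _).
    assert (DX : is_derive (fun s => X s t) th (2 * sin th * cos th * (cos t - a))).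
    { unfold X; auto_derive; trivial; ring. }
    assert (DY : is_derive (fun s => Y s t) th (2 * sin th * cos th * (sin t - b))).
    { unfold Y; auto_derive; trivial; ring. }
    assert (DP1 := is_derive_comp_2d P (fun s => X s t) (fun s => Y s t) th _ _ _ _ DP DX DY).
    assert (DQ1 := is_derive_comp_2d Q (fun s => X s t) (fun s => Y s t) th _ _ _ _ DQ DX DY).
    assert (R := is_derive_minus _ _ _ _ _
        (is_derive_scal_l _ th _ (k t) DP1) (is_derive_scal_l _ th _ (l t) DQ1)).
    unfold F. replace (D th t) with
      (minus (scal (Px (X th t) (Y th t) * (2 * sin th * cos th * (cos t - a)) +
                    Py (X th t) (Y th t) * (2 * sin th * cos th * (sin t - b))) (k t))
             (scal (- Py (X th t) (Y th t) * (2 * sin th * cos th * (cos t - a)) +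
                    Px (X th t) (Y th t) * (2 * sin th * cos th * (sin t - b))) (l t)));
      [exact R |].
    transitivity (2 * sin th * cos th *
      (Px (X th t) (Y th t) * (k t * (cos t - a) - l t * (sin t - b)) +
       Py (X th t) (Y th t) * (k t * (sin t - b) + l t * (cos t - a)))).
    - unfold minus, plus, opp, scal; simpl; unfold mult; simpl. ring.
    - now rewrite K1, K2. }
  assert (CX : forall th t, continuity_2d_pt X th t).
  { intros th t. unfold X.
    apply continuity_2d_pt_plus; [apply continuity_2d_pt_const |].
    apply continuity_2d_pt_mult.
    - apply (continuity_2d_pt_fst (fun u => sin u ^ 2)).
      apply (ex_derive_continuous (fun u => sin u ^ 2)); auto_derive; trivial.
    - apply (continuity_2d_pt_snd (fun u => cos u - a)).
      apply (ex_derive_continuous (fun u => cos u - a)); auto_derive; trivial. }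
  assert (CY : forall th t, continuity_2d_pt Y th t).
  { intros th t. unfold Y.
    apply continuity_2d_pt_plus; [apply continuity_2d_pt_const |].
    apply continuity_2d_pt_mult.
    - apply (continuity_2d_pt_fst (fun u => sin u ^ 2)).
      apply (ex_derive_continuous (fun u => sin u ^ 2)); auto_derive; trivial.
    - apply (continuity_2d_pt_snd (fun u => sin u - b)).
      apply (ex_derive_continuous (fun u => sin u - b)); auto_derive; trivial. }
  assert (CD : forall th t, continuity_2d_pt D th t).
  { intros th t. destruct (Hh _ _ (HXY th t)) as (_ & _ & C1 & C2). unfold D.
    apply continuity_2d_pt_mult.
    - apply (continuity_2d_pt_fst (fun u => 2 * sin u * cos u)).
      apply (ex_derive_continuous (fun u => 2 * sin u * cos u)); auto_derive; trivial.
    - apply continuity_2d_pt_plus; apply continuity_2d_pt_mult.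
      + now apply continuity_2d_pt_comp.
      + apply continuity_2d_pt_snd, continuous_cos.
      + now apply continuity_2d_pt_comp.
      + apply continuity_2d_pt_snd, continuous_sin. }
  assert (CF : forall th t, continuous (fun s => F th s) t).
  { intros th t. destruct (Hh _ _ (HXY th t)) as (DP & DQ & _ & _). unfold F.
    assert (CP := differentiable_pt_lim_continuity _ _ _ _ _ DP).
    assert (CQ := differentiable_pt_lim_continuity _ _ _ _ _ DQ).
    assert (CX1 : continuous (fun s => X th s) t).
    { apply (ex_derive_continuous (fun s => X th s)); unfold X; auto_derive; trivial. }
    assert (CY1 : continuous (fun s => Y th s) t).
    { apply (ex_derive_continuous (fun s => Y th s)); unfold Y; auto_derive; trivial. }
    apply (continuous_minus (V := R_NormedModule));
      apply (continuous_mult (K := R_AbsRing)); trivial.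
    - now apply (continuous_of_2d P (fun s => X th s) (fun s => Y th s)).
    - now apply (continuous_of_2d Q (fun s => X th s) (fun s => Y th s)). }
  assert (DJ : forall th, is_derive (fun s => RInt (fun t => F s t) 0 (2 * PI)) th 0).
  { intros th.
    assert (EJ : RInt (fun t => Derive (fun u => F u t) th) 0 (2 * PI) = 0).
    { transitivity (RInt (fun t => D th t) 0 (2 * PI)).
      { apply RInt_circle_ext; intros t _. apply is_derive_unique, DF. }
      (* The primitive [G] below has [sin th] in its denominator; where that vanishes, [D] vanishes
         too. *)
      destruct (Req_dec (sin th) 0) as [Z | NZ].
      - rewrite (RInt_circle_ext _ (fun _ => 0)).
        + rewrite RInt_Rconst. apply Rmult_0_r.
        + intros t _. unfold D; rewrite Z; ring.
      (* Since [z' = i z], the [t]-derivative of [Q] along the contracted circle is [sin^2 th Im (i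
         phi' z) = sin^2 th Re (phi' z)]. So [G] is a primitive of [D], and it is
         [2 PI]-periodic. *)
      - set (G := fun t => 2 * cos th / sin th * Q (X th t) (Y th t)).
        assert (R : is_RInt (fun t => D th t) 0 (2 * PI) (minus (G (2 * PI)) (G 0))).
        { apply (is_RInt_derive G).
          - intros t _. destruct (Hh _ _ (HXY th t)) as (_ & DQ & _ & _).
            assert (DX : is_derive (fun s => X th s) t (sin th ^ 2 * - sin t)).
            { unfold X; auto_derive; trivial; ring. }
            assert (DY : is_derive (fun s => Y th s) t (sin th ^ 2 * cos t)).
            { unfold Y; auto_derive; trivial; ring. }
            assert (DQ1 := is_derive_comp_2d Q (fun s => X th s) (fun s => Y th s) t _ _ _ _ DQ DX DY).
            apply (is_derive_scal _ t (2 * cos th / sin th)) in DQ1.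
            unfold G. replace (D th t) with
              (2 * cos th / sin th *
               (- Py (X th t) (Y th t) * (sin th ^ 2 * - sin t) +
                Px (X th t) (Y th t) * (sin th ^ 2 * cos t))); [exact DQ1 |].
            unfold D. field. exact NZ.
          - intros t _.
            apply (continuous_of_2d D (fun _ => th) (fun s => s)); [apply CD | |].
            + apply continuous_const.
            + apply continuous_id. }
        rewrite (is_RInt_unique _ _ _ _ R). unfold G, X, Y.
        rewrite cos_2PI, sin_2PI, cos_0, sin_0.
        unfold minus, plus, opp; simpl; ring. }
    cut (is_derive (fun s => RInt (fun t => F s t) 0 (2 * PI)) th
           (RInt (fun t => Derive (fun u => F u t) th) 0 (2 * PI)));
      [now rewrite EJ |].
    apply (is_derive_RInt_param F 0 (2 * PI) th).
    - apply filter_forall; intros s t _. now exists (D s t).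
    - intros t _. apply (continuity_2d_pt_ext D); [| apply CD].
      intros u v. symmetry; apply is_derive_unique, DF.
    - apply filter_forall; intros s. apply (ex_RInt_continuous (V := R_CompleteNormedModule)).
      intros t _. apply CF. }
  (* At [0] the circle has shrunk to the point [w]; at [PI / 2] it is the unit circle. *)
  assert (E : RInt (fun t => F 0 t) 0 (2 * PI) = RInt (fun t => F (PI / 2) t) 0 (2 * PI)).
  { apply (eq_is_derive (fun s => RInt (fun t => F s t) 0 (2 * PI))).
    - intros t _. apply DJ.
    - assert (P0 := PI_RGT_0); lra. }
  transitivity (RInt (fun t => F (PI / 2) t) 0 (2 * PI)).
  - apply RInt_circle_ext; intros t _. unfold F, X, Y. rewrite sin_PI2.
    replace (a + 1 ^ 2 * (cos t - a)) with (cos t) by ring.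
    now replace (b + 1 ^ 2 * (sin t - b)) with (sin t) by ring.
  - rewrite <- E. apply RInt_circle_ext; intros t _. unfold F, X, Y. rewrite sin_0.
    replace (a + 0 ^ 2 * (cos t - a)) with a by ring.
    now replace (b + 0 ^ 2 * (sin t - b)) with b by ring.
Qed.

(** For [w = 0] the kernel [z / (z - w)] is the constant [1]. *)
Lemma mean_value_disc (P Q : R -> R -> R) :
  holo_disc P Q ->
  RInt (fun t => P (cos t) (sin t)) 0 (2 * PI) = 2 * PI * P 0 0.
Proof.
  intros HPQ.
  assert (C := cauchy_disc P Q 0 0 (fun _ => 1) (fun _ => 0) HPQ).
  transitivity (RInt (fun t => P (cos t) (sin t) * 1 - Q (cos t) (sin t) * 0) 0 (2 * PI)).
  { apply RInt_circle_ext; intros t _; simpl; ring. }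
  rewrite C.
  - rewrite RInt_Rconst. change ((2 * PI - 0) * (P 0 0 * 1 - Q 0 0 * 0) = 2 * PI * P 0 0). ring.
  - unfold closed_disc; lra.
  - intros t; apply continuous_const.
  - intros t; apply continuous_const.
  - intros t; ring.
  - intros t; ring.
Qed.

Lemma continuous_on_circle (P Q : R -> R -> R) :
  holo_disc P Q -> forall t, continuous (fun s => P (cos s) (sin s)) t.
Proof.
  intros HPQ t. apply continuous_of_2d; [| apply continuous_cos | apply continuous_sin].
  apply (holo_disc_continuity P Q); [exact HPQ | apply closed_disc_circle].
Qed.

(* The mean of [Re ((P + i Q)^2) = P^2 - Q^2] over the circle is zero. *)
Lemma circle_re_zero_im_zero (P Q : R -> R -> R) :
  holo_disc P Q -> P 0 0 = 0 -> Q 0 0 = 0 ->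
  (forall t, 0 < t < 2 * PI -> P (cos t) (sin t) = 0) ->
  forall t, 0 < t < 2 * PI -> Q (cos t) (sin t) = 0.
Proof.
  intros HPQ P0 Q0 HP t Ht.
  assert (M := mean_value_disc _ _ (holo_disc_mul _ _ _ _ HPQ HPQ)).
  cbv beta in M. rewrite P0, Q0 in M.
  assert (CQ := continuous_on_circle _ _ (holo_disc_rot _ _ HPQ)).
  assert (S : RInt (fun s => Q (cos s) (sin s) * Q (cos s) (sin s)) 0 (2 * PI) = 0).
  { assert (O : RInt (fun s => - (Q (cos s) (sin s) * Q (cos s) (sin s))) 0 (2 * PI)
                = - RInt (fun s => Q (cos s) (sin s) * Q (cos s) (sin s)) 0 (2 * PI)).
    { apply (RInt_opp (V := R_CompleteNormedModule)).
      apply (ex_RInt_continuous (V := R_CompleteNormedModule)); intros s _.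
      apply (continuous_mult (K := R_AbsRing)); apply CQ. }
    rewrite <- (RInt_circle_ext (fun s => P (cos s) (sin s) * P (cos s) (sin s)
                  - Q (cos s) (sin s) * Q (cos s) (sin s))) in O.
    - rewrite M in O. lra.
    - intros s Hs. rewrite (HP s Hs). ring. }
  assert (Z : Q (cos t) (sin t) * Q (cos t) (sin t) = 0).
  { apply (nonneg_RInt_zero (fun s => Q (cos s) (sin s) * Q (cos s) (sin s)) 0 (2 * PI)); trivial.
    - intros s. apply (continuous_mult (K := R_AbsRing)); apply CQ.
    - intros s _. apply Rle_0_sqr. }
  nra.
Qed.

(** Cauchy's formula for [phi] and for [-i phi] gives [phi(w) (K + i L) = 0], where [K] and [L] are
    the integrals of the two parts of the kernel. Positivity of [K] is enough to conclude, so
    neither integral has to be evaluated. *)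
Lemma zero_inside_of_zero_on_circle (P Q : R -> R -> R) (a b : R) :
  holo_disc P Q ->
  (forall t, 0 < t < 2 * PI -> P (cos t) (sin t) = 0) ->
  (forall t, 0 < t < 2 * PI -> Q (cos t) (sin t) = 0) ->
  a ^ 2 + b ^ 2 < 1 -> P a b = 0 /\ Q a b = 0.
Proof.
  intros HPQ HP HQ Hab.
  assert (Pi0 := PI_RGT_0).
  set (d := fun t => (cos t - a) ^ 2 + (sin t - b) ^ 2).
  (* Real and imaginary parts of [z / (z - w) = (1 - z conj(w)) / |z - w|^2], using [|z| = 1]. *)
  set (k := fun t => (1 - a * cos t - b * sin t) / d t).
  set (l := fun t => (b * cos t - a * sin t) / d t).
  assert (Hn : forall t, 0 < 1 - a * cos t - b * sin t).
  { intros t. assert (E := sin2_cos2 t); unfold Rsqr in E.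
    assert (0 <= (a - cos t) ^ 2) by apply pow2_ge_0.
    assert (0 <= (b - sin t) ^ 2) by apply pow2_ge_0. nra. }
  assert (Hd : forall t, 0 < d t).
  { intros t. assert (E := sin2_cos2 t); unfold Rsqr in E. unfold d.
    specialize (Hn t).
    destruct (Req_dec (cos t) a) as [<- | Na].
    - destruct (Req_dec (sin t) b) as [<- | Nb].
      + lra.
      + assert (0 < (sin t - b) ^ 2) by (apply pow2_gt_0; lra). nra.
    - assert (0 < (cos t - a) ^ 2) by (apply pow2_gt_0; lra).
      assert (0 <= (sin t - b) ^ 2) by apply pow2_ge_0. lra. }
  assert (Cc : closed_disc a b) by (unfold closed_disc; lra).
  assert (Ck : forall t, continuous k t).
  { intros t. apply (ex_derive_continuous k). unfold k, d. auto_derive.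
    specialize (Hd t). unfold d in Hd. simpl in Hd. apply Rgt_not_eq. lra. }
  assert (Cl : forall t, continuous l t).
  { intros t. apply (ex_derive_continuous l). unfold l, d. auto_derive.
    specialize (Hd t). unfold d in Hd. simpl in Hd. apply Rgt_not_eq. lra. }
  assert (K1 : forall t, k t * (cos t - a) - l t * (sin t - b) = cos t).
  { intros t. assert (E := sin2_cos2 t); unfold Rsqr in E. specialize (Hd t).
    apply Rmult_eq_reg_r with (d t); [| lra].
    transitivity ((1 - a * cos t - b * sin t) * (cos t - a) - (b * cos t - a * sin t) * (sin t - b)).
    - unfold k, l. field. lra.
    - unfold d. replace 1 with (sin t * sin t + cos t * cos t). ring. }
  assert (K2 : forall t, k t * (sin t - b) + l t * (cos t - a) = sin t).
  { intros t. assert (E := sin2_cos2 t); unfold Rsqr in E. specialize (Hd t).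
    apply Rmult_eq_reg_r with (d t); [| lra].
    transitivity ((1 - a * cos t - b * sin t) * (sin t - b) + (b * cos t - a * sin t) * (cos t - a)).
    - unfold k, l. field. lra.
    - unfold d. replace 1 with (sin t * sin t + cos t * cos t). ring. }
  assert (Xk : ex_RInt k 0 (2 * PI)) by (apply (ex_RInt_continuous (V := R_CompleteNormedModule)); auto).
  assert (Xl : ex_RInt l 0 (2 * PI)) by (apply (ex_RInt_continuous (V := R_CompleteNormedModule)); auto).
  assert (Kpos : 0 < RInt k 0 (2 * PI)).
  { apply RInt_gt_0; [lra | | auto].
    intros t _. unfold k. apply Rdiv_lt_0_compat; auto. }
  assert (Z : forall p q : R -> R -> R, holo_disc p q ->
     (forall t, 0 < t < 2 * PI -> p (cos t) (sin t) = 0) ->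
     (forall t, 0 < t < 2 * PI -> q (cos t) (sin t) = 0) ->
     p a b * RInt k 0 (2 * PI) - q a b * RInt l 0 (2 * PI) = 0).
  { intros p q Hpq Hp Hq.
    transitivity (RInt (fun t => p a b * k t - q a b * l t) 0 (2 * PI)).
    - symmetry. apply is_RInt_unique.
      apply (is_RInt_minus (V := R_NormedModule));
        apply (is_RInt_scal (V := R_NormedModule)); now apply (RInt_correct (V := R_CompleteNormedModule)).
    - rewrite <- (cauchy_disc p q a b k l Hpq Cc Ck Cl K1 K2).
      rewrite (RInt_circle_ext _ (fun _ => 0)).
      + rewrite RInt_Rconst. apply Rmult_0_r.
      + intros t Ht. rewrite (Hp t Ht), (Hq t Ht). ring. }
  assert (Z1 := Z P Q HPQ HP HQ).
  assert (Z2 : Q a b * RInt k 0 (2 * PI) - - P a b * RInt l 0 (2 * PI) = 0).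
  { apply (Z Q (fun x y => - P x y)); [now apply holo_disc_rot | exact HQ |].
    intros t Ht; rewrite (HP t Ht); ring. }
  set (p := P a b) in *. set (q := Q a b) in *.
  set (K := RInt k 0 (2 * PI)) in *. set (L := RInt l 0 (2 * PI)) in *.
  assert (S : (p * p + q * q) * K = 0).
  { transitivity (p * (p * K - q * L) + q * (q * K - - p * L)); [ring | rewrite Z1, Z2; ring]. }
  apply Rmult_integral in S. destruct S as [S | S]; [| lra].
  split; nra.
Qed.

(** The Cauchy kernel is singular when [w] lies on the circle, so boundary points are reached as
    radial limits from inside. *)
Lemma continuity_zero_of_open_disc (P : R -> R -> R) (x y : R) :
  (forall a b, a ^ 2 + b ^ 2 < 1 -> P a b = 0) ->
  closed_disc x y -> continuity_2d_pt P x y -> P x y = 0.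
Proof.
  unfold closed_disc; intros HP Hxy C.
  destruct (Req_dec (P x y) 0) as [E | NE]; [exact E | exfalso].
  destruct (continuity_2d_pt_neq_0 P x y C NE) as [d Hd].
  assert (Pd := cond_pos d).
  (* [d / 2] keeps the contracted point in the neighbourhood where [P] is nonzero, [1 / 2] makes the
     contraction strict. *)
  set (s := Rmin (d / 2) (1 / 2)).
  assert (0 < s) by (apply Rmin_pos; lra).
  assert (s <= d / 2) by apply Rmin_l.
  assert (s <= 1 / 2) by apply Rmin_r.
  assert (Bx : Rabs x <= 1) by (apply Rabs_le; nra).
  assert (By : Rabs y <= 1) by (apply Rabs_le; nra).
  apply (Hd ((1 - s) * x) ((1 - s) * y)).
  - replace ((1 - s) * x - x) with (- s * x) by ring.
    rewrite Rabs_mult, Rabs_Ropp, (Rabs_pos_eq s) by lra. nra.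
  - replace ((1 - s) * y - y) with (- s * y) by ring.
    rewrite Rabs_mult, Rabs_Ropp, (Rabs_pos_eq s) by lra. nra.
  - apply HP. replace (((1 - s) * x) ^ 2 + ((1 - s) * y) ^ 2)
      with ((1 - s) ^ 2 * (x ^ 2 + y ^ 2)) by ring.
    assert (0 <= (1 - s) ^ 2 < 1) by nra.
    assert (0 <= x ^ 2 + y ^ 2) by nra. nra.
Qed.

Lemma zero_on_disc_of_zero_on_circle (P Q : R -> R -> R) :
  holo_disc P Q ->
  (forall t, 0 < t < 2 * PI -> P (cos t) (sin t) = 0) ->
  (forall t, 0 < t < 2 * PI -> Q (cos t) (sin t) = 0) ->
  forall x y, closed_disc x y -> P x y = 0 /\ Q x y = 0.
Proof.
  intros HPQ HP HQ x y Hxy.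
  assert (Z := fun a b => zero_inside_of_zero_on_circle P Q a b HPQ HP HQ).
  destruct (holo_disc_continuity P Q x y HPQ Hxy) as [CP CQ].
  split; apply continuity_zero_of_open_disc; trivial; intros a b Hab; now apply Z.
Qed.

(** * Smooth maps on open sets *)

Lemma open2_locally (U : R -> R -> Prop) (x y : R) :
  open2 U -> U x y -> locally_2d U x y.
Proof.
  intros HU Hxy. destruct (HU x y Hxy) as (e & He & H).
  (* [locally_2d] uses squares; the one of half-side [e / 2] fits in the disc of radius [e]. *)
  assert (He2 : 0 < e / 2) by lra.
  exists (mkposreal _ He2); simpl. intros u v Hu Hv. apply H.
  apply Rabs_def2 in Hu. apply Rabs_def2 in Hv. nra.
Qed.

Lemma pds_app (w w' : list bool) (g : R -> R -> R) : pds (w ++ w') g = pds w (pds w' g).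
Proof. induction w as [| d w IH]; simpl; [reflexivity | now rewrite IH]. Qed.

Lemma smooth_on_pd (U : R -> R -> Prop) (g : R -> R -> R) (d : bool) :
  smooth_on U g -> smooth_on U (pd d g).
Proof.
  intros Hg w p q Hpq. change (pd d g) with (pds (d :: nil) g).
  rewrite <- pds_app. now apply Hg.
Qed.

Lemma smooth_on_continuity (U : R -> R -> Prop) (g : R -> R -> R) (x y : R) :
  smooth_on U g -> U x y -> continuity_2d_pt g x y.
Proof.
  intros Hg Hxy. destruct (Hg nil x y Hxy) as (_ & _ & C).
  now apply continuity_2d_pt_filterlim.
Qed.

Lemma smooth_on_differentiable (U : R -> R -> Prop) (g : R -> R -> R) (x y : R) :
  open2 U -> smooth_on U g -> U x y ->
  differentiable_pt_lim g x y (pdx g x y) (pdy g x y).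
Proof.
  intros HU Hg Hxy. apply filterdiff_differentiable_pt_lim.
  apply (is_derive_filterdiff g x y (pdx g) (pdy g x y)).
  - apply (proj1 (locally_2d_locally (fun u v => is_derive (fun z => g z v) u (pdx g u v)) x y)).
    apply (locally_2d_impl U); [| now apply open2_locally].
    apply locally_2d_forall; intros u v Huv.
    apply Derive_correct. exact (proj1 (Hg nil u v Huv)).
  - apply Derive_correct. exact (proj1 (proj2 (Hg nil x y Hxy))).
  - exact (proj2 (proj2 (Hg (true :: nil) x y Hxy))).
Qed.

Lemma smooth_on_schwarz (U : R -> R -> Prop) (g : R -> R -> R) (x y : R) :
  open2 U -> smooth_on U g -> U x y -> pdx (pdy g) x y = pdy (pdx g) x y.
Proof.
  intros HU Hg Hxy. apply (Schwarz g x y).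
  - apply (locally_2d_impl U); [| now apply open2_locally].
    apply locally_2d_forall; intros u v Huv.
    destruct (Hg nil u v Huv) as (H1 & H2 & _).
    destruct (Hg (true :: nil) u v Huv) as (_ & H3 & _).
    destruct (Hg (false :: nil) u v Huv) as (H4 & _ & _).
    repeat split; assumption.
  - apply (smooth_on_continuity U (pd true (pd false g))); [| exact Hxy].
    now do 2 apply smooth_on_pd.
  - apply (smooth_on_continuity U (pd false (pd true g))); [| exact Hxy].
    now do 2 apply smooth_on_pd.
Qed.

Lemma vsmooth_on_vpdx (U : R -> R -> Prop) (F : R -> R -> V3) :
  vsmooth_on U F -> vsmooth_on U (vpdx F).
Proof. intros (H1 & H2 & H3). split; [| split]; [exact (smooth_on_pd U _ true H1) | exact (smooth_on_pd U _ true H2) | exact (smooth_on_pd U _ true H3)]. Qed.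

Lemma vsmooth_on_vpdy (U : R -> R -> Prop) (F : R -> R -> V3) :
  vsmooth_on U F -> vsmooth_on U (vpdy F).
Proof. intros (H1 & H2 & H3). split; [| split]; [exact (smooth_on_pd U _ false H1) | exact (smooth_on_pd U _ false H2) | exact (smooth_on_pd U _ false H3)]. Qed.

Lemma vsmooth_on_schwarz (U : R -> R -> Prop) (F : R -> R -> V3) (x y : R) :
  open2 U -> vsmooth_on U F -> U x y -> vpdx (vpdy F) x y = vpdy (vpdx F) x y.
Proof.
  intros HU (H1 & H2 & H3) Hxy.
  assert (E1 := smooth_on_schwarz U _ x y HU H1 Hxy).
  assert (E2 := smooth_on_schwarz U _ x y HU H2 Hxy).
  assert (E3 := smooth_on_schwarz U _ x y HU H3 Hxy).
  unfold vpdx at 1, vpdy at 4. f_equal; assumption.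
Qed.

Lemma vpdy_ext (U : R -> R -> Prop) (F G : R -> R -> V3) (x y : R) :
  open2 U -> U x y -> (forall u v, U u v -> F u v = G u v) -> vpdy F x y = vpdy G x y.
Proof.
  intros HU Hxy E.
  assert (L : locally y (fun t => F x t = G x t)).
  { apply locally_2d_1d_const_x with (P := fun u v => F u v = G u v).
    apply (locally_2d_impl U); [apply locally_2d_forall; exact E | now apply open2_locally]. }
  unfold vpdy, pdy, comp1, comp2, comp3.
  f_equal; apply Derive_ext_loc; revert L; apply filter_imp; intros t Ht; now rewrite Ht.
Qed.

(** Product-rule derivatives of the inner product, kept expanded so that the algebra below sees both
    terms. *)
Definition dot_pdx (F G : R -> R -> V3) (x y : R) : R :=
  dot (vpdx F x y) (G x y) + dot (F x y) (vpdx G x y).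
Definition dot_pdy (F G : R -> R -> V3) (x y : R) : R :=
  dot (vpdy F x y) (G x y) + dot (F x y) (vpdy G x y).

Lemma dot_differentiable (U : R -> R -> Prop) (F G : R -> R -> V3) (x y : R) :
  open2 U -> vsmooth_on U F -> vsmooth_on U G -> U x y ->
  differentiable_pt_lim (fun u v => dot (F u v) (G u v)) x y
    (dot_pdx F G x y) (dot_pdy F G x y).
Proof.
  intros HU (F1 & F2 & F3) (G1 & G2 & G3) Hxy.
  assert (S := fun g Hg => smooth_on_differentiable U g x y HU Hg Hxy).
  eapply differentiable_pt_lim_eq.
  - apply (differentiable_pt_lim_plus (fun u v => comp1 F u v * comp1 G u v + comp2 F u v * comp2 G u v)
      (fun u v => comp3 F u v * comp3 G u v)).
    + apply (differentiable_pt_lim_plus (fun u v => comp1 F u v * comp1 G u v)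
        (fun u v => comp2 F u v * comp2 G u v)); apply differentiable_pt_lim_mult; apply S; assumption.
    + apply differentiable_pt_lim_mult; apply S; assumption.
  - unfold dot_pdx, dot, vpdx, comp1, comp2, comp3; simpl; ring.
  - unfold dot_pdy, dot, vpdy, comp1, comp2, comp3; simpl; ring.
Qed.

Lemma dot_continuity (U : R -> R -> Prop) (F G : R -> R -> V3) (x y : R) :
  vsmooth_on U F -> vsmooth_on U G -> U x y ->
  continuity_2d_pt (fun u v => dot (F u v) (G u v)) x y.
Proof.
  intros (F1 & F2 & F3) (G1 & G2 & G3) Hxy. unfold dot.
  repeat apply continuity_2d_pt_plus; apply continuity_2d_pt_mult;
    apply (smooth_on_continuity U); assumption.
Qed.

Lemma dot_pd_continuity (U : R -> R -> Prop) (F G : R -> R -> V3) (x y : R) :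
  vsmooth_on U F -> vsmooth_on U G -> U x y ->
  continuity_2d_pt (dot_pdx F G) x y /\ continuity_2d_pt (dot_pdy F G) x y.
Proof.
  intros HF HG Hxy.
  assert (Fx := vsmooth_on_vpdx U F HF). assert (Gx := vsmooth_on_vpdx U G HG).
  assert (Fy := vsmooth_on_vpdy U F HF). assert (Gy := vsmooth_on_vpdy U G HG).
  unfold dot_pdx, dot_pdy.
  split; apply continuity_2d_pt_plus; apply (dot_continuity U); assumption.
Qed.

(** Allows an identity valid on [U] to be differentiated; the structure equations of the surface are
    all obtained this way. *)
Lemma differentiable_eq_on (U : R -> R -> Prop) (f g : R -> R -> R) (x y fx fy gx gy : R) :
  open2 U -> U x y -> (forall u v, U u v -> f u v = g u v) ->
  differentiable_pt_lim f x y fx fy -> differentiable_pt_lim g x y gx gy ->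
  fx = gx /\ fy = gy.
Proof.
  intros HU Hxy E Df Dg.
  assert (Df' : differentiable_pt_lim g x y fx fy).
  { apply (differentiable_pt_lim_ext f); [| exact Df].
    apply (locally_2d_impl U); [apply locally_2d_forall; exact E | now apply open2_locally]. }
  apply differentiable_pt_lim_unique in Df'. apply differentiable_pt_lim_unique in Dg.
  destruct Df', Dg; split; congruence.
Qed.

Lemma dot_const_on (U : R -> R -> Prop) (F G : R -> R -> V3) (c x y : R) :
  open2 U -> vsmooth_on U F -> vsmooth_on U G -> U x y ->
  (forall u v, U u v -> dot (F u v) (G u v) = c) ->
  dot_pdx F G x y = 0 /\ dot_pdy F G x y = 0.
Proof.
  intros HU HF HG Hxy E.
  apply (differentiable_eq_on U (fun u v => dot (F u v) (G u v)) (fun _ _ => c) x y); trivial.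
  - now apply (dot_differentiable U).
  - apply differentiable_pt_lim_const.
Qed.

(** * Vector algebra *)

Lemma dot_comm (a b : V3) : dot a b = dot b a.
Proof. unfold dot; ring. Qed.

Lemma dot_vadd_l (a b c : V3) : dot (vadd a b) c = dot a c + dot b c.
Proof. unfold dot, vadd; simpl; ring. Qed.

Lemma dot_vscale_l (r : R) (a b : V3) : dot (vscale r a) b = r * dot a b.
Proof. unfold dot, vscale; simpl; ring. Qed.

(** Squared determinant as a Gram determinant: everything becomes inner products, whatever the
    orientation. *)
Lemma gram_det (u v n : V3) :
  dot (cross u v) n ^ 2 =
  dot u u * dot v v * dot n n + 2 * dot u v * dot v n * dot u n
  - dot u u * dot v n ^ 2 - dot v v * dot u n ^ 2 - dot n n * dot u v ^ 2.
Proof. destruct u, v, n; unfold dot, cross; simpl; ring. Qed.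

Lemma orthogonal_to_basis (u v n c : V3) :
  dot (cross u v) n <> 0 -> dot c u = 0 -> dot c v = 0 -> dot c n = 0 -> c = mkV3 0 0 0.
Proof.
  intros D Hu Hv Hn.
  (* Cramer's rule: [c] times the determinant, expanded in the dual basis. *)
  assert (E : forall w, dot (cross u v) n * dot c w =
     dot c u * dot (cross v n) w + dot c v * dot (cross n u) w + dot c n * dot (cross u v) w).
  { intros w. destruct u, v, n, c, w; unfold dot, cross; simpl; ring. }
  rewrite Hu, Hv, Hn in E.
  assert (Z : forall w, dot c w = 0).
  { intros w. apply Rmult_eq_reg_l with (dot (cross u v) n); [rewrite E; ring | exact D]. }
  assert (Z1 := Z (mkV3 1 0 0)). assert (Z2 := Z (mkV3 0 1 0)). assert (Z3 := Z (mkV3 0 0 1)).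
  destruct c as [c1 c2 c3]; unfold dot in Z1, Z2, Z3; simpl in *. f_equal; lra.
Qed.

Lemma dot_orthogonal_frame (u v n a b : V3) (e : R) :
  0 < e -> dot u u = e -> dot v v = e -> dot n n = 1 ->
  dot u v = 0 -> dot n u = 0 -> dot n v = 0 ->
  dot a b = (dot a u * dot b u + dot a v * dot b v) / e + dot a n * dot b n.
Proof.
  intros He Huu Hvv Hnn Huv Hnu Hnv.
  (* The remainder of [b] after projection to the frame; it is orthogonal to the frame, hence
     zero. *)
  set (c := vadd b (vadd (vscale (- (dot b u / e)) u)
                (vadd (vscale (- (dot b v / e)) v) (vscale (- dot b n) n)))).
  assert (Dc : forall w, dot c w =
     dot b w - dot b u / e * dot u w - dot b v / e * dot v w - dot b n * dot n w).
  { intros w. unfold c. rewrite !dot_vadd_l, !dot_vscale_l. ring. }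
  assert (Hvu : dot v u = 0) by now rewrite dot_comm.
  assert (Hun : dot u n = 0) by now rewrite dot_comm.
  assert (Hvn : dot v n = 0) by now rewrite dot_comm.
  assert (Zc : c = mkV3 0 0 0).
  { apply (orthogonal_to_basis u v n).
    - intros Z. assert (G := gram_det u v n).
      rewrite Z, Huu, Hvv, Hnn, Huv, Hun, Hvn in G. nra.
    - rewrite Dc, Huu, Hvu, Hnu. field. lra.
    - rewrite Dc, Huv, Hvv, Hnv. field. lra.
    - rewrite Dc, Hun, Hvn, Hnn. field. lra. }
  assert (Za := Dc a). rewrite Zc in Za.
  replace (dot (mkV3 0 0 0) a) with 0 in Za by (unfold dot; simpl; ring).
  rewrite (dot_comm a b), (dot_comm a u), (dot_comm a v), (dot_comm a n).
  apply Rminus_diag_uniq. rewrite Za. field. lra.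
Qed.

(** * The Hopf differential *)

Record cmc_immersion (H : R) (U : R -> R -> Prop) (f N : R -> R -> V3) : Prop := {
  cmc_open : open2 U;
  cmc_disc : forall x y, closed_disc x y -> U x y;
  cmc_smooth : vsmooth_on U f;
  cmc_conformal : conformal_on U f;
  cmc_normal : unit_normal_on U f N;
  cmc_smooth_normal : vsmooth_on U N;
  cmc_mean_curv : forall x y, U x y -> mean_curv f N x y = H }.

Definition metric (f : R -> R -> V3) (x y : R) : R := dot (vpdx f x y) (vpdx f x y).
Definition II11 (f N : R -> R -> V3) (x y : R) : R := dot (vpdx (vpdx f) x y) (N x y).
Definition II12 (f N : R -> R -> V3) (x y : R) : R := dot (vpdy (vpdx f) x y) (N x y).
Definition II22 (f N : R -> R -> V3) (x y : R) : R := dot (vpdy (vpdy f) x y) (N x y).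

(* The Hopf differential is [(hopf_re + i hopf_im) dz^2], up to a constant factor. *)
Definition hopf_re (f N : R -> R -> V3) (x y : R) : R := (II11 f N x y - II22 f N x y) / 2.
Definition hopf_im (f N : R -> R -> V3) (x y : R) : R := - II12 f N x y.

Lemma II_trace (H : R) (U : R -> R -> Prop) (f N : R -> R -> V3) (x y : R) :
  cmc_immersion H U f N -> U x y -> II11 f N x y + II22 f N x y = 2 * H * metric f x y.
Proof.
  intros S Hxy. rewrite <- (cmc_mean_curv _ _ _ _ S x y Hxy).
  destruct (cmc_conformal _ _ _ _ S x y Hxy) as (_ & P & _).
  unfold mean_curv, II11, II22, metric in *. rewrite dot_vadd_l. field. lra.
Qed.

(** Derivatives of [<N, N> = 1], [<N, f_x> = 0] and [<N, f_y> = 0]. *)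
Lemma weingarten (H : R) (U : R -> R -> Prop) (f N : R -> R -> V3) (x y : R) :
  cmc_immersion H U f N -> U x y ->
  (dot (vpdx N x y) (vpdx f x y) = - II11 f N x y /\
   dot (vpdx N x y) (vpdy f x y) = - II12 f N x y /\
   dot (vpdx N x y) (N x y) = 0) /\
  (dot (vpdy N x y) (vpdx f x y) = - II12 f N x y /\
   dot (vpdy N x y) (vpdy f x y) = - II22 f N x y /\
   dot (vpdy N x y) (N x y) = 0).
Proof.
  intros S Hxy. destruct S as [HU _ Hf _ HN HsN _].
  assert (Hfx := vsmooth_on_vpdx U f Hf). assert (Hfy := vsmooth_on_vpdy U f Hf).
  assert (Sch := vsmooth_on_schwarz U f x y HU Hf Hxy).
  destruct (dot_const_on U N N 1 x y) as [A1 A2]; trivial. { intros; now apply HN. }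
  destruct (dot_const_on U N (vpdx f) 0 x y) as [B1 B2]; trivial. { intros; now apply HN. }
  destruct (dot_const_on U N (vpdy f) 0 x y) as [C1 C2]; trivial. { intros; now apply HN. }
  unfold dot_pdx, dot_pdy in *. rewrite Sch in C1.
  unfold II11, II12, II22.
  rewrite (dot_comm (N x y)) in A1, A2, B1, B2, C1, C2.
  repeat split; lra.
Qed.

(** Derivatives of the two conformality relations. They express all tangential parts of the second
    derivatives by [<f_xx, f_x> = E_x / 2] and [<f_xy, f_x> = E_y / 2]: the Christoffel symbols of a
    conformal metric. *)
Lemma conformal_derivatives (H : R) (U : R -> R -> Prop) (f N : R -> R -> V3) (x y : R) :
  cmc_immersion H U f N -> U x y ->
  let fx := vpdx f x y in let fy := vpdy f x y in
  let fxx := vpdx (vpdx f) x y in let fxy := vpdy (vpdx f) x y in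
  let fyy := vpdy (vpdy f) x y in
  dot fxy fy = dot fxx fx /\ dot fyy fy = dot fxy fx /\
  dot fxx fy = - dot fxy fx /\ dot fyy fx = - dot fxx fx.
Proof.
  intros S Hxy. destruct S as [HU _ Hf HC _ _ _]. cbv zeta.
  assert (Hfx := vsmooth_on_vpdx U f Hf). assert (Hfy := vsmooth_on_vpdy U f Hf).
  assert (Sch := vsmooth_on_schwarz U f x y HU Hf Hxy).
  destruct (dot_const_on U (vpdx f) (vpdy f) 0 x y) as [A1 A2]; trivial.
  { intros; now apply HC. }
  destruct (differentiable_eq_on U (fun u v => dot (vpdx f u v) (vpdx f u v))
    (fun u v => dot (vpdy f u v) (vpdy f u v)) x y
    (dot_pdx (vpdx f) (vpdx f) x y) (dot_pdy (vpdx f) (vpdx f) x y)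
    (dot_pdx (vpdy f) (vpdy f) x y) (dot_pdy (vpdy f) (vpdy f) x y)) as [B1 B2]; trivial.
  { intros; now apply HC. }
  { now apply (dot_differentiable U). }
  { now apply (dot_differentiable U). }
  unfold dot_pdx, dot_pdy in *. rewrite Sch in *.
  rewrite (dot_comm (vpdx f x y)) in A1, A2, B1, B2.
  rewrite (dot_comm (vpdy f x y)) in B1, B2.
  repeat split; lra.
Qed.

Lemma cmc_frame (H : R) (U : R -> R -> Prop) (f N : R -> R -> V3) (x y : R) (a b : V3) :
  cmc_immersion H U f N -> U x y ->
  dot a b = (dot a (vpdx f x y) * dot b (vpdx f x y)
             + dot a (vpdy f x y) * dot b (vpdy f x y)) / metric f x y
            + dot a (N x y) * dot b (N x y).
Proof.
  intros S Hxy.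
  destruct (cmc_conformal _ _ _ _ S x y Hxy) as (C1 & C2 & C3).
  destruct (cmc_normal _ _ _ _ S x y Hxy) as (N1 & N2 & N3).
  apply dot_orthogonal_frame; trivial. now rewrite <- C1.
Qed.

(* The Codazzi equations: constancy of [H] makes them the Cauchy-Riemann equations
   of the Hopf differential. *)
Lemma codazzi (H : R) (U : R -> R -> Prop) (f N : R -> R -> V3) (x y : R) :
  cmc_immersion H U f N -> U x y ->
  dot_pdx (vpdy (vpdx f)) N x y
    = (dot_pdy (vpdx (vpdx f)) N x y - dot_pdy (vpdy (vpdy f)) N x y) / 2 /\
  - dot_pdy (vpdy (vpdx f)) N x y
    = (dot_pdx (vpdx (vpdx f)) N x y - dot_pdx (vpdy (vpdy f)) N x y) / 2.
Proof.
  intros S Hxy.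
  assert (W := weingarten H U f N x y S Hxy).
  assert (D := conformal_derivatives H U f N x y S Hxy). cbv zeta in D.
  assert (T := II_trace H U f N x y S Hxy).
  assert (FR := fun a b => cmc_frame H U f N x y a b S Hxy).
  assert (Epos : 0 < metric f x y) by apply (cmc_conformal _ _ _ _ S x y Hxy).
  assert (S' := S). destruct S' as [HU _ Hf _ _ HN _].
  assert (Hfx := vsmooth_on_vpdx U f Hf). assert (Hfy := vsmooth_on_vpdy U f Hf).
  assert (Hfxx := vsmooth_on_vpdx U _ Hfx). assert (Hfxy := vsmooth_on_vpdy U _ Hfx).
  assert (Hfyy := vsmooth_on_vpdy U _ Hfy).
  (* By symmetry of third derivatives [M_x] and [L_y] share the term [<f_xxy, N>], and [M_y] and
     [N'_x] share [<f_xyy, N>]. *)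
  assert (S1 := vsmooth_on_schwarz U _ x y HU Hfx Hxy).
  assert (S2 : vpdx (vpdy (vpdy f)) x y = vpdy (vpdy (vpdx f)) x y).
  { rewrite (vsmooth_on_schwarz U (vpdy f) x y HU Hfy Hxy).
    apply (vpdy_ext U); trivial. intros u v Huv. now apply (vsmooth_on_schwarz U). }
  destruct (differentiable_eq_on U (fun u v => II11 f N u v + II22 f N u v)
    (fun u v => 2 * H * metric f u v) x y
    (dot_pdx (vpdx (vpdx f)) N x y + dot_pdx (vpdy (vpdy f)) N x y)
    (dot_pdy (vpdx (vpdx f)) N x y + dot_pdy (vpdy (vpdy f)) N x y)
    (2 * H * dot_pdx (vpdx f) (vpdx f) x y)
    (2 * H * dot_pdy (vpdx f) (vpdx f) x y)) as [T1 T2]; trivial.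
  { intros u v Huv. now apply (II_trace H U). }
  { apply differentiable_pt_lim_plus; now apply (dot_differentiable U). }
  { apply differentiable_pt_lim_scal. now apply (dot_differentiable U). }
  unfold dot_pdx, dot_pdy in *.
  rewrite S1, S2 in *.
  rewrite (dot_comm (vpdx f x y)) in T1, T2.
  destruct W as ((W1 & W2 & W3) & (W4 & W5 & W6)).
  destruct D as (D1 & D2 & D3 & D4).
  rewrite (FR (vpdy (vpdx f) x y) (vpdx N x y)), (FR (vpdy (vpdx f) x y) (vpdy N x y)).
  rewrite (FR (vpdx (vpdx f) x y) (vpdx N x y)), (FR (vpdx (vpdx f) x y) (vpdy N x y)) in *.
  rewrite (FR (vpdy (vpdy f) x y) (vpdx N x y)), (FR (vpdy (vpdy f) x y) (vpdy N x y)) in *.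
  rewrite ?W1, ?W2, ?W3, ?W4, ?W5, ?W6, ?D1, ?D2, ?D3, ?D4 in *.
  set (e := metric f x y) in *.
  set (p := dot (vpdx (vpdx f) x y) (vpdx f x y)) in *.
  set (q := dot (vpdy (vpdx f) x y) (vpdx f x y)) in *.
  set (l := II11 f N x y) in *. set (m := II12 f N x y) in *. set (n := II22 f N x y) in *.
  assert (Hn : n = 2 * H * e - l) by lra. rewrite Hn in *.
  clearbody e p q l m n.
  replace (H) with ((l + n) / (2 * e)) in * by (rewrite Hn; field; lra).
  (* [b + c] is a derivative of the trace [2 H E]. It is compared with twice [b - a], respectively
     twice [c - a], where the third derivatives cancel and only products of first and second
     fundamental data remain. *)
  split.
  - match goal with |- ?a = (?b - ?c) / 2 => assert (b + c = 2 * b - 2 * a -> a = (b - c) / 2) as X by lra end.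
    apply X; clear X. rewrite T2. field. lra.
  - match goal with |- - ?a = (?b - ?c) / 2 => assert (b + c = 2 * c - 2 * a -> - a = (b - c) / 2) as X by lra end.
    apply X; clear X. rewrite T1. field. lra.
Qed.

Lemma hopf_holo (H : R) (U : R -> R -> Prop) (f N : R -> R -> V3) :
  cmc_immersion H U f N -> holo_disc (hopf_re f N) (hopf_im f N).
Proof.
  intros S.
  exists (fun x y => (dot_pdx (vpdx (vpdx f)) N x y - dot_pdx (vpdy (vpdy f)) N x y) / 2),
         (fun x y => (dot_pdy (vpdx (vpdx f)) N x y - dot_pdy (vpdy (vpdy f)) N x y) / 2).
  intros x y Hd. assert (Hxy := cmc_disc _ _ _ _ S x y Hd).
  destruct (codazzi H U f N x y S Hxy) as [K1 K2].
  destruct S as [HU _ Hf _ _ HN _].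
  assert (Hfx := vsmooth_on_vpdx U f Hf). assert (Hfy := vsmooth_on_vpdy U f Hf).
  assert (Hfxx := vsmooth_on_vpdx U _ Hfx). assert (Hfxy := vsmooth_on_vpdy U _ Hfx).
  assert (Hfyy := vsmooth_on_vpdy U _ Hfy).
  destruct (dot_pd_continuity U _ _ x y Hfxx HN Hxy) as [C1 C2].
  destruct (dot_pd_continuity U _ _ x y Hfyy HN Hxy) as [C3 C4].
  unfold Rdiv. repeat split.
  - apply (differentiable_pt_lim_ext (fun u v => / 2 * (II11 f N u v - II22 f N u v))).
    { apply locally_2d_forall; intros; unfold hopf_re; lra. }
    eapply differentiable_pt_lim_eq.
    + apply differentiable_pt_lim_scal, differentiable_pt_lim_minus;
        apply (dot_differentiable U); eassumption.
    + ring.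
    + ring.
  - apply (differentiable_pt_lim_ext (fun u v => -1 * II12 f N u v)).
    { apply locally_2d_forall; intros; unfold hopf_im; lra. }
    eapply differentiable_pt_lim_eq.
    + apply differentiable_pt_lim_scal. apply (dot_differentiable U); eassumption.
    + rewrite K1; field.
    + rewrite <- Rdiv_def, <- K2; ring.
  - apply continuity_2d_pt_mult; [now apply continuity_2d_pt_minus | apply continuity_2d_pt_const].
  - apply continuity_2d_pt_mult; [now apply continuity_2d_pt_minus | apply continuity_2d_pt_const].
Qed.

(** In conformal coordinates the first form is [E] times the identity, so proportionality means
    [L = N'] and [M = 0]. *)
Lemma umbilic_iff_hopf_zero (H : R) (U : R -> R -> Prop) (f N : R -> R -> V3) (x y : R) :
  cmc_immersion H U f N -> U x y ->
  umbilic f N x y <-> hopf_re f N x y = 0 /\ hopf_im f N x y = 0.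
Proof.
  intros S Hxy. destruct (cmc_conformal _ _ _ _ S x y Hxy) as (C1 & C2 & C3).
  unfold umbilic, hopf_re, hopf_im, II11, II12, II22. split.
  - intros (lam & U1 & U2 & U3). rewrite U1, U2, U3, C3, C1. split; lra.
  - intros (E1 & E2).
    exists (dot (vpdx (vpdx f) x y) (N x y) / dot (vpdx f x y) (vpdx f x y)).
    rewrite C3, <- C1. repeat split; [field | |]; try lra.
    replace (dot (vpdy (vpdy f) x y) (N x y)) with (dot (vpdx (vpdx f) x y) (N x y)) by lra.
    field. lra.
Qed.

(** * Curvatures of the boundary curve *)

(** [vderive] rests on the total function [Derive]; this relation also asserts that the derivative
    exists, as the sum and product rules require. *)
Definition vis_derive (c : R -> V3) (t : R) (d : V3) : Prop :=
  is_derive (fun s => v1 (c s)) t (v1 d) /\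
  is_derive (fun s => v2 (c s)) t (v2 d) /\
  is_derive (fun s => v3 (c s)) t (v3 d).

Lemma vis_derive_unique (c : R -> V3) (t : R) (d : V3) : vis_derive c t d -> vderive c t = d.
Proof.
  intros (D1 & D2 & D3). destruct d as [d1 d2 d3]. unfold vderive.
  f_equal; now apply is_derive_unique.
Qed.

Lemma vis_derive_ext (c c' : R -> V3) (t : R) (d : V3) :
  (forall s, c s = c' s) -> vis_derive c t d -> vis_derive c' t d.
Proof.
  intros E (D1 & D2 & D3).
  split; [| split]; (eapply is_derive_ext; [| eassumption]); intros s; simpl; now rewrite E.
Qed.

Lemma is_derive_Rplus (g h : R -> R) (t dg dh : R) :
  is_derive g t dg -> is_derive h t dh -> is_derive (fun s => g s + h s) t (dg + dh).
Proof. exact (fun Dg Dh => is_derive_plus g h t dg dh Dg Dh). Qed.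

Lemma is_derive_Rmult (g h : R -> R) (t dg dh : R) :
  is_derive g t dg -> is_derive h t dh ->
  is_derive (fun s => g s * h s) t (dg * h t + g t * dh).
Proof. exact (fun Dg Dh => is_derive_mult g h t dg dh Dg Dh Rmult_comm). Qed.

Lemma is_derive_Rminus (g h : R -> R) (t dg dh : R) :
  is_derive g t dg -> is_derive h t dh -> is_derive (fun s => g s - h s) t (dg - dh).
Proof. exact (fun Dg Dh => is_derive_minus g h t dg dh Dg Dh). Qed.

Lemma vis_derive_vadd (c c' : R -> V3) (t : R) (d d' : V3) :
  vis_derive c t d -> vis_derive c' t d' ->
  vis_derive (fun s => vadd (c s) (c' s)) t (vadd d d').
Proof.
  intros (D1 & D2 & D3) (D1' & D2' & D3').
  split; [| split]; simpl; now apply is_derive_Rplus.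
Qed.

Lemma vis_derive_vscale (r : R -> R) (c : R -> V3) (t dr : R) (d : V3) :
  is_derive r t dr -> vis_derive c t d ->
  vis_derive (fun s => vscale (r s) (c s)) t (vadd (vscale dr (c t)) (vscale (r t) d)).
Proof.
  intros Dr (D1 & D2 & D3).
  split; [| split]; simpl.
  - now apply (is_derive_Rmult r (fun s => v1 (c s))).
  - now apply (is_derive_Rmult r (fun s => v2 (c s))).
  - now apply (is_derive_Rmult r (fun s => v3 (c s))).
Qed.

Lemma vis_derive_cross (c c' : R -> V3) (t : R) (d d' : V3) :
  vis_derive c t d -> vis_derive c' t d' ->
  vis_derive (fun s => cross (c s) (c' s)) t (vadd (cross d (c' t)) (cross (c t) d')).
Proof.
  intros (D1 & D2 & D3) (D1' & D2' & D3').
  assert (X : forall a b a' b' : R -> R, forall da db da' db' : R,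
    is_derive a t da -> is_derive b t db -> is_derive a' t da' -> is_derive b' t db' ->
    is_derive (fun s => a s * b' s - b s * a' s) t
      (da * b' t - db * a' t + (a t * db' - b t * da'))).
  { intros a b a' b' da db da' db' Ha Hb Ha' Hb'.
    replace (da * b' t - db * a' t + (a t * db' - b t * da'))
      with ((da * b' t + a t * db') - (db * a' t + b t * da')) by ring.
    apply is_derive_Rminus; now apply is_derive_Rmult. }
  split; [| split]; simpl.
  - now apply (X (fun s => v2 (c s)) (fun s => v3 (c s)) (fun s => v2 (c' s)) (fun s => v3 (c' s))).
  - now apply (X (fun s => v3 (c s)) (fun s => v1 (c s)) (fun s => v3 (c' s)) (fun s => v1 (c' s))).
  - now apply (X (fun s => v1 (c s)) (fun s => v2 (c s)) (fun s => v1 (c' s)) (fun s => v2 (c' s))).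
Qed.

Definition circle_derive (F : R -> R -> V3) (t : R) : V3 :=
  vadd (vscale (- sin t) (vpdx F (cos t) (sin t))) (vscale (cos t) (vpdy F (cos t) (sin t))).

Lemma vis_derive_circle (U : R -> R -> Prop) (F : R -> R -> V3) (t : R) :
  open2 U -> vsmooth_on U F -> U (cos t) (sin t) ->
  vis_derive (fun s => F (cos s) (sin s)) t (circle_derive F t).
Proof.
  intros HU (F1 & F2 & F3) Ht.
  assert (X : forall g, smooth_on U g -> is_derive (fun s => g (cos s) (sin s)) t
     (- sin t * pdx g (cos t) (sin t) + cos t * pdy g (cos t) (sin t))).
  { intros g Hg.
    replace (- sin t * pdx g (cos t) (sin t) + cos t * pdy g (cos t) (sin t))
      with (pdx g (cos t) (sin t) * - sin t + pdy g (cos t) (sin t) * cos t) by ring.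
    apply is_derive_comp_2d.
    - exact (smooth_on_differentiable U g _ _ HU Hg Ht).
    - apply is_derive_cos.
    - apply is_derive_sin. }
  split; [| split].
  - exact (X _ F1).
  - exact (X _ F2).
  - exact (X _ F3).
Qed.

Section Boundary.
Context (H : R) (U : R -> R -> Prop) (f N : R -> R -> V3) (S : cmc_immersion H U f N).

Let circle_in (t : R) : U (cos t) (sin t) := cmc_disc H U f N S _ _ (closed_disc_circle t).
Let HU : open2 U := cmc_open H U f N S.

Lemma vderive_gam (t : R) : vderive (gam f) t = circle_derive f t.
Proof.
  apply vis_derive_unique.
  exact (vis_derive_circle U f t HU (cmc_smooth _ _ _ _ S) (circle_in t)).
Qed.

Lemma metric_pos (t : R) : 0 < metric f (cos t) (sin t).
Proof. exact (proj1 (proj2 (cmc_conformal _ _ _ _ S _ _ (circle_in t)))). Qed.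

(** The circle has unit velocity [(- sin t, cos t)] in the parameter plane, and a conformal map
    stretches it by [sqrt E]. *)
Lemma speed_eq (t : R) : speed f t = sqrt (metric f (cos t) (sin t)).
Proof.
  unfold speed, vnorm. rewrite vderive_gam. f_equal.
  destruct (cmc_conformal _ _ _ _ S _ _ (circle_in t)) as (C1 & _ & C3).
  unfold circle_derive. rewrite !dot_vadd_l, !dot_vscale_l.
  rewrite (dot_comm _ (vadd _ _)), (dot_comm _ (vadd _ _)), !dot_vadd_l, !dot_vscale_l.
  rewrite (dot_comm (vpdy f _ _) (vpdx f _ _)), C3, <- C1.
  unfold metric. assert (E := sin2_cos2 t); unfold Rsqr in E.
  set (e := dot _ _). replace e with (e * 1) at 3 by ring. rewrite <- E. ring.
Qed.

Lemma tangX_eq (t : R) :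
  tangX f t = vscale (/ sqrt (metric f (cos t) (sin t))) (circle_derive f t).
Proof. unfold tangX. now rewrite speed_eq, vderive_gam. Qed.

Definition accel (t : R) : V3 :=
  vadd (vadd (vscale (- cos t) (vpdx f (cos t) (sin t)))
             (vscale (- sin t) (circle_derive (vpdx f) t)))
       (vadd (vscale (- sin t) (vpdy f (cos t) (sin t)))
             (vscale (cos t) (circle_derive (vpdy f) t))).

Lemma vis_derive_velocity (t : R) : vis_derive (circle_derive f) t (accel t).
Proof.
  apply vis_derive_vadd.
  - apply (vis_derive_vscale (fun s => - sin s) (fun s => vpdx f (cos s) (sin s))).
    + apply (is_derive_opp sin t (cos t)), is_derive_sin.
    + exact (vis_derive_circle U _ t HU (vsmooth_on_vpdx U f (cmc_smooth _ _ _ _ S)) (circle_in t)).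
  - apply (vis_derive_vscale cos (fun s => vpdy f (cos s) (sin s))).
    + apply is_derive_cos.
    + exact (vis_derive_circle U _ t HU (vsmooth_on_vpdy U f (cmc_smooth _ _ _ _ S)) (circle_in t)).
Qed.

(** The derivative [dr] of the inverse speed stays anonymous: it multiplies a tangent vector, which
    pairing with [N] kills. *)
Lemma vderive_tangX (t : R) : exists dr,
  vis_derive (tangX f) t
    (vadd (vscale dr (circle_derive f t))
          (vscale (/ sqrt (metric f (cos t) (sin t))) (accel t))).
Proof.
  assert (Hfx := vsmooth_on_vpdx U f (cmc_smooth _ _ _ _ S)).
  assert (D := is_derive_comp_2d (metric f) cos sin t _ _ _ _
    (dot_differentiable U _ _ _ _ HU Hfx Hfx (circle_in t))
    (is_derive_cos t) (is_derive_sin t)).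
  assert (P := metric_pos t).
  assert (X : ex_derive (fun s => / sqrt (metric f (cos s) (sin s))) t).
  { apply ex_derive_inv.
    - apply (ex_derive_comp sqrt (fun s => metric f (cos s) (sin s))).
      + auto_derive. exact P.
      + eexists; exact D.
    - apply Rgt_not_eq, sqrt_lt_R0, P. }
  destruct X as [dr Dr]. exists dr.
  eapply vis_derive_ext; [intros s; symmetry; apply tangX_eq |].
  apply (vis_derive_vscale (fun s => / sqrt (metric f (cos s) (sin s))) (circle_derive f)).
  - exact Dr.
  - apply vis_derive_velocity.
Qed.

Lemma circle_derive_normal (t : R) : dot (circle_derive f t) (N (cos t) (sin t)) = 0.
Proof.
  destruct (cmc_normal _ _ _ _ S _ _ (circle_in t)) as (_ & N2 & N3).
  unfold circle_derive. rewrite dot_vadd_l, !dot_vscale_l.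
  rewrite (dot_comm (vpdx f _ _)), (dot_comm (vpdy f _ _)), N2, N3. ring.
Qed.

(* [boundary_re + i boundary_im = z^2 (hopf_re + i hopf_im)] *)
Definition boundary_re (x y : R) : R :=
  (x * x - y * y) * hopf_re f N x y - (x * y + y * x) * hopf_im f N x y.
Definition boundary_im (x y : R) : R :=
  (x * x - y * y) * hopf_im f N x y + (x * y + y * x) * hopf_re f N x y.

Lemma boundary_holo : holo_disc boundary_re boundary_im.
Proof.
  apply (holo_disc_mul (fun x y => x * x - y * y) (fun x y => x * y + y * x)).
  - apply (holo_disc_mul (fun x _ => x) (fun _ y => y)); apply holo_disc_id.
  - exact (hopf_holo H U f N S).
Qed.

Lemma boundary_re_0 : boundary_re 0 0 = 0.
Proof. unfold boundary_re; ring. Qed.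

Lemma boundary_im_0 : boundary_im 0 0 = 0.
Proof. unfold boundary_im; ring. Qed.

(** The second fundamental form on [(- sin t, cos t)], divided by [E]. Splitting it into its trace
    [2 H E] and its trace-free part gives [H E - Re (z^2 phi)]. *)
Lemma kappa_n_eq (t : R) :
  kappa_n f N t = H - boundary_re (cos t) (sin t) / metric f (cos t) (sin t).
Proof.
  assert (P := metric_pos t).
  destruct (vderive_tangX t) as [dr D].
  unfold kappa_n. rewrite (vis_derive_unique _ _ _ D), speed_eq.
  change (Nb N t) with (N (cos t) (sin t)).
  rewrite dot_vadd_l, !dot_vscale_l, circle_derive_normal.
  assert (A : dot (accel t) (N (cos t) (sin t)) =
     sin t * sin t * II11 f N (cos t) (sin t) - 2 * sin t * cos t * II12 f N (cos t) (sin t)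
     + cos t * cos t * II22 f N (cos t) (sin t)).
  { unfold accel, circle_derive. rewrite !dot_vadd_l, !dot_vscale_l, !dot_vadd_l, !dot_vscale_l.
    destruct (cmc_normal _ _ _ _ S _ _ (circle_in t)) as (_ & N2 & N3).
    rewrite (vsmooth_on_schwarz U f _ _ HU (cmc_smooth _ _ _ _ S) (circle_in t)).
    rewrite (dot_comm (vpdx f _ _)), (dot_comm (vpdy f _ _)), N2, N3.
    unfold II11, II12, II22. ring. }
  rewrite A. assert (T := II_trace H U f N _ _ S (circle_in t)).
  assert (E := sin2_cos2 t); unfold Rsqr in E.
  unfold boundary_re, hopf_re, hopf_im.
  set (e := metric f (cos t) (sin t)) in *.
  set (l := II11 f N (cos t) (sin t)) in *. set (m := II12 f N (cos t) (sin t)) in *.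
  set (n := II22 f N (cos t) (sin t)) in *.
  set (x := cos t) in *. set (y := sin t) in *.
  assert (Q := sqrt_sqrt e (Rlt_le _ _ P)). assert (Q0 := sqrt_lt_R0 e P).
  (* One [sqrt E] comes from normalizing [X], the other from [d/ds]. *)
  transitivity ((y * y * l - 2 * y * x * m + x * x * n) / (sqrt e * sqrt e)).
  { field. lra. }
  rewrite Q. apply Rmult_eq_reg_r with e; [| lra].
  replace ((H - ((x * x - y * y) * ((l - n) / 2) - (x * y + y * x) * - m) / e) * e)
    with (H * e * 1 - ((x * x - y * y) * ((l - n) / 2) - (x * y + y * x) * - m)) by (field; lra).
  rewrite <- E. replace (H * e) with ((l + n) / 2) by lra. field. lra.
Qed.

(* Squaring avoids the orientation of [N], i.e. the sign of [det (f_x, f_y, N)]. *)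
Lemma tau_g_sqr (t : R) :
  (tau_g f N t * metric f (cos t) (sin t)) ^ 2 = boundary_im (cos t) (sin t) ^ 2.
Proof.
  assert (P := metric_pos t).
  destruct (vderive_tangX t) as [dr D].
  assert (DN := vis_derive_circle U N t HU (cmc_smooth_normal _ _ _ _ S) (circle_in t)).
  assert (DY := vis_derive_cross _ _ _ _ _ DN D).
  unfold tau_g.
  change (vderive (conY f N) t) with (vderive (fun s => cross (N (cos s) (sin s)) (tangX f s)) t).
  rewrite (vis_derive_unique _ _ _ DY), speed_eq, tangX_eq.
  change (Nb N t) with (N (cos t) (sin t)).
  set (e := metric f (cos t) (sin t)) in *.
  set (c := circle_derive f t) in *. set (d := circle_derive N t) in *.
  set (n := N (cos t) (sin t)) in *.
  (* In [Y' = N' * X + N * X'] (cross products) the second summand is orthogonal to [N], which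
     leaves a determinant. *)
  assert (A : forall w r, dot (vadd (cross d (vscale r c)) (cross n w)) n = r * dot (cross d c) n).
  { intros w r. destruct d, c, n, w; unfold dot, vadd, cross, vscale; simpl; ring. }
  rewrite A.
  assert (Q := sqrt_sqrt e (Rlt_le _ _ P)). assert (Q0 := sqrt_lt_R0 e P).
  replace (/ sqrt e * dot (cross d c) n / sqrt e * e)
    with (dot (cross d c) n / (sqrt e * sqrt e) * e) by (field; lra).
  rewrite Q. replace (dot (cross d c) n / e * e) with (dot (cross d c) n) by (field; lra).
  rewrite gram_det.
  destruct (weingarten H U f N _ _ S (circle_in t)) as ((W1 & W2 & W3) & (W4 & W5 & W6)).
  destruct (cmc_normal _ _ _ _ S _ _ (circle_in t)) as (N1 & _ & _).
  assert (Hdn : dot d n = 0).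
  { unfold d, circle_derive. rewrite dot_vadd_l, !dot_vscale_l. unfold n. rewrite W3, W6. ring. }
  assert (Hcn : dot c n = 0) by apply circle_derive_normal.
  assert (Hcc : dot c c = e).
  { assert (E := speed_eq t). unfold speed, vnorm in E. rewrite vderive_gam in E.
    apply sqrt_inj; [| lra | exact E].
    unfold c, dot. nra. }
  assert (Hdx : dot d (vpdx f (cos t) (sin t)) =
    sin t * II11 f N (cos t) (sin t) - cos t * II12 f N (cos t) (sin t)).
  { unfold d, circle_derive. rewrite dot_vadd_l, !dot_vscale_l, W1, W4. ring. }
  assert (Hdy : dot d (vpdy f (cos t) (sin t)) =
    sin t * II12 f N (cos t) (sin t) - cos t * II22 f N (cos t) (sin t)).
  { unfold d, circle_derive. rewrite dot_vadd_l, !dot_vscale_l, W2, W5. ring. }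
  assert (Hdc : dot d c = - sin t * dot d (vpdx f (cos t) (sin t))
                          + cos t * dot d (vpdy f (cos t) (sin t))).
  { rewrite dot_comm. unfold c, circle_derive. rewrite dot_vadd_l, !dot_vscale_l.
    now rewrite !(dot_comm d). }
  rewrite Hcn, Hdn, Hcc, Hdc.
  rewrite (cmc_frame H U f N _ _ d d S (circle_in t)).
  fold e n. rewrite Hdn, Hdx, Hdy. change (dot n n = 1) in N1. rewrite N1.
  assert (E := sin2_cos2 t); unfold Rsqr in E.
  unfold boundary_im, hopf_re, hopf_im.
  set (i11 := II11 f N (cos t) (sin t)). set (i12 := II12 f N (cos t) (sin t)).
  set (i22 := II22 f N (cos t) (sin t)).
  set (x := cos t) in *. set (y := sin t) in *.
  clearbody e i11 i12 i22 x y.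
  set (p := y * i11 - x * i12). set (q := y * i12 - x * i22).
  (* Since [(- y, x)] is a unit vector, Lagrange's identity turns this into [(x * p + y * q) ^ 2],
     and [x * p + y * q] is [boundary_im]. *)
  transitivity (1 * (p * p + q * q) - (- y * p + x * q) ^ 2); [field; lra |].
  rewrite <- E. unfold p, q. field.
Qed.

(** * From boundary values to umbilicity and back *)

(** Multiplication by the conjugate of [z^2], with [|z| = 1]. *)
Lemma hopf_zero_on_circle (t : R) :
  boundary_re (cos t) (sin t) = 0 -> boundary_im (cos t) (sin t) = 0 ->
  hopf_re f N (cos t) (sin t) = 0 /\ hopf_im f N (cos t) (sin t) = 0.
Proof.
  unfold boundary_re, boundary_im. assert (E := sin2_cos2 t); unfold Rsqr in E.
  set (a := hopf_re _ _ _ _). set (b := hopf_im _ _ _ _).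
  set (x := cos t) in *. set (y := sin t) in *. intros R I.
  assert (A : a * ((y * y + x * x) * (y * y + x * x)) = 0).
  { transitivity ((x * x - y * y) * ((x * x - y * y) * a - (x * y + y * x) * b)
      + (x * y + y * x) * ((x * x - y * y) * b + (x * y + y * x) * a)); [ring |].
    rewrite R, I; ring. }
  assert (B : b * ((y * y + x * x) * (y * y + x * x)) = 0).
  { transitivity ((x * x - y * y) * ((x * x - y * y) * b + (x * y + y * x) * a)
      - (x * y + y * x) * ((x * x - y * y) * a - (x * y + y * x) * b)); [ring |].
    rewrite R, I; ring. }
  rewrite E in A, B. lra.
Qed.

Lemma umbilic_of_boundary_zero :
  (forall t, 0 < t < 2 * PI -> boundary_re (cos t) (sin t) = 0) ->
  (forall t, 0 < t < 2 * PI -> boundary_im (cos t) (sin t) = 0) ->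
  totally_umbilic_disc f N.
Proof.
  intros R I x y Hd.
  apply (umbilic_iff_hopf_zero H U f N x y S (cmc_disc _ _ _ _ S x y Hd)).
  apply zero_on_disc_of_zero_on_circle; trivial.
  - exact (hopf_holo H U f N S).
  - intros t Ht. now apply (hopf_zero_on_circle t (R t Ht) (I t Ht)).
  - intros t Ht. now apply (hopf_zero_on_circle t (R t Ht) (I t Ht)).
Qed.

Lemma umbilic_of_boundary_re_zero :
  (forall t, 0 < t < 2 * PI -> boundary_re (cos t) (sin t) = 0) -> totally_umbilic_disc f N.
Proof.
  intros R. apply umbilic_of_boundary_zero; [exact R |].
  exact (circle_re_zero_im_zero _ _ boundary_holo boundary_re_0 boundary_im_0 R).
Qed.

Lemma umbilic_of_boundary_im_zero :
  (forall t, 0 < t < 2 * PI -> boundary_im (cos t) (sin t) = 0) -> totally_umbilic_disc f N.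
Proof.
  intros I. apply umbilic_of_boundary_zero; [| exact I].
  intros t Ht.
  assert (Z := circle_re_zero_im_zero _ _ (holo_disc_rot _ _ boundary_holo) boundary_im_0
    (eq_trans (f_equal Ropp boundary_re_0) Ropp_0) I t Ht).
  cbv beta in Z. lra.
Qed.

Lemma boundary_re_mean : RInt (fun t => boundary_re (cos t) (sin t)) 0 (2 * PI) = 0.
Proof. rewrite (mean_value_disc _ _ boundary_holo), boundary_re_0. apply Rmult_0_r. Qed.

Lemma boundary_im_mean : RInt (fun t => boundary_im (cos t) (sin t)) 0 (2 * PI) = 0.
Proof.
  rewrite (mean_value_disc _ _ (holo_disc_rot _ _ boundary_holo)), boundary_im_0. apply Rmult_0_r.
Qed.

(** The factor [s] treats both signs at once, and with them both strict inequalities for [H]. *)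
Lemma umbilic_of_boundary_re_sign (s : R) : s <> 0 ->
  (forall t, 0 <= t <= 2 * PI -> 0 <= s * boundary_re (cos t) (sin t)) ->
  totally_umbilic_disc f N.
Proof.
  intros Hs Hpos. apply umbilic_of_boundary_re_zero. intros t Ht.
  assert (C := continuous_on_circle _ _ boundary_holo).
  assert (Z : s * boundary_re (cos t) (sin t) = 0).
  { apply (nonneg_RInt_zero (fun t => s * boundary_re (cos t) (sin t)) 0 (2 * PI)); trivial.
    - intros r. apply (continuous_mult (K := R_AbsRing)); [apply continuous_const | apply C].
    - transitivity (s * RInt (fun t => boundary_re (cos t) (sin t)) 0 (2 * PI)).
      + apply (RInt_scal (V := R_CompleteNormedModule)).
        apply (ex_RInt_continuous (V := R_CompleteNormedModule)); intros; apply C.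
      + rewrite boundary_re_mean. apply Rmult_0_r. }
  apply Rmult_integral in Z. tauto.
Qed.

(** A zero of the mean-zero function [boundary_re] identifies the constant as [H]. *)
Lemma umbilic_of_kappa_n_const : const_on_circle (kappa_n f N) -> totally_umbilic_disc f N.
Proof.
  intros K. assert (Z := PI_RGT_0).
  destruct (RInt_zero_has_root (fun t => boundary_re (cos t) (sin t)) 0 (2 * PI))
    as (t0 & Ht0 & E0); [lra | | apply boundary_re_mean |].
  { apply (continuous_on_circle _ _ boundary_holo). }
  apply umbilic_of_boundary_re_zero. intros t Ht.
  assert (E := K t t0 ltac:(lra) Ht0).
  rewrite !kappa_n_eq, E0 in E. assert (P := metric_pos t).
  apply Rmult_eq_reg_r with (/ metric f (cos t) (sin t)).
  - unfold Rdiv in E. lra.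
  - apply Rgt_not_eq, Rinv_0_lt_compat, P.
Qed.

Lemma umbilic_of_tau_g_const : const_on_circle (tau_g f N) -> totally_umbilic_disc f N.
Proof.
  intros K. assert (Z := PI_RGT_0).
  destruct (RInt_zero_has_root (fun t => boundary_im (cos t) (sin t)) 0 (2 * PI))
    as (t0 & Ht0 & E0); [lra | | apply boundary_im_mean |].
  { apply (continuous_on_circle _ _ (holo_disc_rot _ _ boundary_holo)). }
  assert (T0 : tau_g f N t0 = 0).
  { assert (Q := tau_g_sqr t0). rewrite E0 in Q. assert (P := metric_pos t0).
    assert (Q' : tau_g f N t0 * metric f (cos t0) (sin t0) = 0) by nra.
    apply Rmult_integral in Q'. destruct Q'; [assumption | lra]. }
  apply umbilic_of_boundary_im_zero. intros t Ht.
  assert (Q := tau_g_sqr t). rewrite (K t t0 ltac:(lra) Ht0), T0 in Q. nra.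
Qed.

Lemma boundary_zero_of_umbilic (t : R) : totally_umbilic_disc f N ->
  boundary_re (cos t) (sin t) = 0 /\ boundary_im (cos t) (sin t) = 0.
Proof.
  intros T.
  destruct (proj1 (umbilic_iff_hopf_zero H U f N _ _ S (circle_in t))
                  (T _ _ (closed_disc_circle t))) as [A B].
  unfold boundary_re, boundary_im. rewrite A, B. split; ring.
Qed.

Lemma kappa_n_of_umbilic (t : R) : totally_umbilic_disc f N -> kappa_n f N t = H.
Proof.
  intros T. rewrite kappa_n_eq, (proj1 (boundary_zero_of_umbilic t T)).
  unfold Rdiv. ring.
Qed.

Lemma tau_g_of_umbilic (t : R) : totally_umbilic_disc f N -> tau_g f N t = 0.
Proof.
  intros T. assert (Q := tau_g_sqr t).
  rewrite (proj2 (boundary_zero_of_umbilic t T)) in Q. assert (P := metric_pos t).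
  assert (Q' : tau_g f N t * metric f (cos t) (sin t) = 0) by nra.
  apply Rmult_integral in Q'. destruct Q'; [assumption | lra].
Qed.

(** [s = 1] gives a value below [H], [s = -1] one above. Otherwise [H - kappa_n], hence
    [boundary_re], would have constant sign. *)
Lemma kappa_n_strict_bound (s : R) : s <> 0 -> ~ totally_umbilic_disc f N ->
  exists t, 0 <= t <= 2 * PI /\ s * (kappa_n f N t - H) < 0.
Proof.
  intros Hs T. apply Classical_Prop.NNPP. intros NE. apply T.
  apply (umbilic_of_boundary_re_sign (- s)); [lra |].
  intros t Ht. assert (P := metric_pos t).
  destruct (Rlt_or_le (s * (kappa_n f N t - H)) 0) as [L | G]; [exfalso; eauto |].
  rewrite kappa_n_eq in G.
  replace (- s * boundary_re (cos t) (sin t)) with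
    (s * (H - boundary_re (cos t) (sin t) / metric f (cos t) (sin t) - H)
     * metric f (cos t) (sin t)) by (field; lra).
  apply Rmult_le_pos; lra.
Qed.

End Boundary.

(** A strict bound against the minimum or maximum of [kappa_n] is expressed by a point of the circle
    where the inequality holds. *)
Theorem theorem1p1 (H : R) (U : R -> R -> Prop) (f N : R -> R -> V3) :
  open2 U ->
  (forall x y, closed_disc x y -> U x y) ->
  vsmooth_on U f ->
  conformal_on U f ->
  unit_normal_on U f N ->
  vsmooth_on U N ->
  (forall x y, U x y -> mean_curv f N x y = H) ->
  regular_analytic_boundary f ->
  ((totally_umbilic_disc f N <->
      (const_on_circle (kappa_n f N) \/ const_on_circle (tau_g f N))) /\
   (totally_umbilic_disc f N ->
      (forall t, 0 <= t <= 2 * PI -> kappa_n f N t = H) /\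
      (forall t, 0 <= t <= 2 * PI -> tau_g f N t = 0))) /\
  (~ totally_umbilic_disc f N ->
     (exists t1, 0 <= t1 <= 2 * PI /\ kappa_n f N t1 < H) /\
     (exists t2, 0 <= t2 <= 2 * PI /\ H < kappa_n f N t2)).
Proof.
  intros HU Hd Hf HC HN HsN HH _.
  assert (S := Build_cmc_immersion H U f N HU Hd Hf HC HN HsN HH).
  split; [split; [split |] |].
  - intros T. left. intros t1 t2 _ _. now rewrite !(kappa_n_of_umbilic H U f N S).
  - intros [K | K].
    + exact (umbilic_of_kappa_n_const H U f N S K).
    + exact (umbilic_of_tau_g_const H U f N S K).
  - intros T. split; intros t _.
    + exact (kappa_n_of_umbilic H U f N S t T).
    + exact (tau_g_of_umbilic H U f N S t T).
  - intros T. split.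
    + destruct (kappa_n_strict_bound H U f N S 1) as (t & Ht & L); [lra | exact T |].
      exists t; split; [exact Ht | lra].
    + destruct (kappa_n_strict_bound H U f N S (-1)) as (t & Ht & L); [lra | exact T |].
      exists t; split; [exact Ht | lra].
Qed.
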